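(* Let $\Sigma\in\mathcal{G}_n$ and let $Q_0$ be the unique regular rational orthogonal matrix with $Q_0^{\rm T}S(\Sigma)Q_0=S(\Sigma^{\rm T})$. If $Q_0$ is not factorable, then $\Sigma$ is weakly determined by the generalized skew-spectrum (WDGSS).
   Context: An oriented graph on vertices $v_1,\dots,v_n$ is a simple graph with each edge directed; its skew-adjacency matrix $S(\Sigma)=(s_{ij})$ has $s_{ij}=1$ if $(v_i,v_j)$ is an arc, $-1$ if $(v_j,v_i)$ is an arc, $0$ otherwise. The converse $\Sigma^{\rm T}$ reverses every arc, so $S(\Sigma^{\rm T})=-S(\Sigma)$. Two oriented graphs are isomorphic if their skew-adjacency matrices are conjugate by a permutation matrix; they are generalized cospectral if their skew-adjacency matrices $S$ have the same spectrum and the matrices $J-I-S$ have the same spectrum. $\Sigma$ is WDGSS if every oriented graph generalized cospectral with $\Sigma$ is isomorphic to $\Sigma$ or to $\Sigma^{\rm T}$. With $e$ the all-one vector, $W(\Sigma)=[e,Se,\dots,S^{n-1}e]$, $S=S(\Sigma)$. $\mathcal{G}_n$ is the set of $n$-vertex oriented graphs with $2^{-\lfloor n/2\rfloor}\det W(\Sigma)$ an odd square-free integer. A rational orthogonal matrix $Q$ is regular if $Qe=e$; its level is the least positive integer $k$ with $kQ$ integral. A regular rational orthogonal matrix of level $\ell$ is factorable if it can be written as the product of two regular rational orthogonal matrices of smaller levels, neither of which is a permutation matrix. Since $\det W(\Sigma)\ne0$, $Q_0$ exists and is unique. *)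

(* Defs.v *)
From HB Require Import structures.
From mathcomp Require Import all_boot all_order.
From mathcomp Require Import fingroup perm.
From mathcomp Require Import all_algebra.
Set Implicit Arguments. Unset Strict Implicit. Unset Printing Implicit Defensive.
Import Order.TTheory GRing.Theory Num.Theory.
Local Open Scope ring_scope.

Definition oriented (n : nat) (arc : rel 'I_n) : Prop :=
  (forall i, ~~ arc i i) /\ (forall i j, arc i j -> ~~ arc j i).

Definition skew_adj (n : nat) (arc : rel 'I_n) : 'M[rat]_n :=
  \matrix_(i, j) (if arc i j then 1 else if arc j i then -1 else 0).

Definition converse (n : nat) (arc : rel 'I_n) : rel 'I_n :=
  fun i j => arc j i.

Definition isomorphic (n : nat) (a b : rel 'I_n) : Prop :=
  exists s : 'S_n,
    (perm_mx s)^T *m skew_adj a *m perm_mx s = skew_adj b.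

Definition ones (n : nat) : 'cV[rat]_n := const_mx 1.
Definition Jmx (n : nat) : 'M[rat]_n := const_mx 1.

Definition gen_cospectral (n : nat) (a b : rel 'I_n) : Prop :=
  char_poly (skew_adj a) = char_poly (skew_adj b) /\
  char_poly (Jmx n - 1%:M - skew_adj a) = char_poly (Jmx n - 1%:M - skew_adj b).

Definition WDGSS (n : nat) (a : rel 'I_n) : Prop :=
  forall b : rel 'I_n, oriented b -> gen_cospectral a b ->
    isomorphic b a \/ isomorphic b (converse a).

Definition walk_mx (n : nat) (S : 'M[rat]_n) : 'M[rat]_n :=
  \matrix_(i, j) ((S ^+ j *m ones n) i ord0).

Definition squarefree (m : nat) : bool :=
  [forall p : 'I_m.+1, prime p ==> ~~ (p * p %| m)%N].

Definition in_Gn (n : nat) (arc : rel 'I_n) : Prop :=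
  exists z : int,
    \det (walk_mx (skew_adj arc)) = (2 ^+ (n./2)) * z%:~R /\
    odd `|z|%N /\ squarefree `|z|%N.

Definition reg_rat_orth (n : nat) (Q : 'M[rat]_n) : Prop :=
  Q *m Q^T = 1%:M /\ Q *m ones n = ones n.

Definition int_mx (n : nat) (A : 'M[rat]_n) : Prop :=
  forall i j, A i j \is a Num.int.

Definition is_level (n : nat) (Q : 'M[rat]_n) (l : nat) : Prop :=
  (0 < l)%N /\ int_mx (l%:R *: Q) /\
  (forall k : nat, (0 < k)%N -> int_mx (k%:R *: Q) -> (l <= k)%N).

Definition factorable (n : nat) (Q : 'M[rat]_n) : Prop :=
  exists (Q1 Q2 : 'M[rat]_n) (l l1 l2 : nat),
    is_level Q l /\ Q = Q1 *m Q2 /\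
    reg_rat_orth Q1 /\ reg_rat_orth Q2 /\
    is_level Q1 l1 /\ is_level Q2 l2 /\ (l1 < l)%N /\ (l2 < l)%N /\
    ~~ is_perm_mx Q1 /\ ~~ is_perm_mx Q2.

(* Main.v *)
(* Let S be the skew-adjacency matrix, e the all-one vector and W the walk matrix. A graph
   generalized cospectral with the given one yields a regular rational orthogonal Q with
   Q^T S Q = S', and Q0 Q plays the same role for the converse of that graph. The point is that the
   levels of Q and Q0 Q are coprime, square-free and divide the level of Q0; hence
   Q0 = (Q0 Q) Q^T is a forbidden factorization unless Q or Q0 Q is a permutation matrix.
   This is checked prime by prime on the lattice K = Z_p[S] e, whose index in L = Z_p^n is the
   p-part of det W and which is contained in the unimodular lattice Q L. For p = 2, a computation
   modulo 4 of the norms of the elements of K gives Q L = L. If p is odd and divides det W, then K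
   has index p in L, so that at most two unimodular lattices contain K (the isotropic lines of the
   plane K^*/K over F_p). Hence Q L and Q0 L coincide as soon as both differ from L. Finally
   Q0 L = L forces Q L = L: otherwise S would act on L/K as 0, and then Q0, which anticommutes with
   S, would have to act on L/K by both 1 and -1. *)
Require Import Defs.
From mathcomp Require Import all_boot all_order.
From mathcomp Require Import fingroup perm.
From mathcomp Require Import all_algebra.
From mathcomp Require Import zify ring.
Set Implicit Arguments. Unset Strict Implicit. Unset Printing Implicit Defensive.
Import Order.TTheory GRing.Theory Num.Theory.
Local Open Scope ring_scope.

(** * Krylov vectors and minimal annihilators modulo p *)

Section Krylov.
Variables (R : comNzRingType) (n' : nat).
Local Notation n := n'.+1.
Implicit Types (A : 'M[R]_n) (f g : {poly R}).

Definition kry A f : 'cV[R]_n := horner_mx A f *m const_mx 1.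

Definition krylov A k : 'M[R]_(n, k) := \matrix_(i, j) kry A 'X^j i 0.

Lemma kryD A f g : kry A (f + g) = kry A f + kry A g.
Proof. by rewrite /kry raddfD mulmxDl. Qed.

Lemma kryB A f g : kry A (f - g) = kry A f - kry A g.
Proof. by rewrite /kry raddfB mulmxBl. Qed.

Lemma kryZ A c f : kry A (c *: f) = c *: kry A f.
Proof. by rewrite /kry linearZ -scalemxAl. Qed.

Lemma kry0 A : kry A 0 = 0.
Proof. by rewrite /kry raddf0 mul0mx. Qed.

Lemma kry1 A : kry A 1 = const_mx 1.
Proof. by rewrite /kry rmorph1 mul1mx. Qed.

Lemma kryM A f g : kry A (f * g) = horner_mx A f *m kry A g.
Proof. by rewrite /kry rmorphM mulmxA. Qed.

Lemma kryXM A f : kry A ('X * f) = A *m kry A f.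
Proof. by rewrite kryM horner_mx_X. Qed.

Lemma horner_mxXn A k : horner_mx A 'X^k = A ^+ k.
Proof. by rewrite rmorphXn /= horner_mx_X. Qed.

Lemma kryXn A k : kry A 'X^k = A ^+ k *m const_mx 1.
Proof. by rewrite /kry horner_mxXn. Qed.

Lemma krylov_mul A k (c : 'cV[R]_k) : krylov A k *m c = kry A (rVpoly c^T).
Proof.
rewrite /rVpoly poly_def /kry raddf_sum /= mulmx_suml.
apply/colP=> i; rewrite mxE summxE; apply: eq_bigr => j _.
rewrite linearZ /= -scalemxAl mxE mulrC mxE insubT //= => lt_jk.
by rewrite !mxE; congr (c _ 0 * _); apply/val_inj.
Qed.

Lemma kry_krylov A k f : (size f <= k)%N ->
  kry A f = krylov A k *m (poly_rV f : 'rV_k)^T.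
Proof. by move=> le_fk; rewrite krylov_mul trmxK poly_rV_K. Qed.

End Krylov.

Lemma map_kry (aR rR : comNzRingType) (phi : {rmorphism aR -> rR}) n'
    (A : 'M[aR]_n'.+1) f :
  map_mx phi (kry A f) = kry (map_mx phi A) (map_poly phi f).
Proof.
by rewrite /kry map_mxM -map_horner_mx; congr mulmx; apply/matrixP=> i j; rewrite !mxE rmorph1.
Qed.

Lemma map_krylov (aR rR : comNzRingType) (phi : {rmorphism aR -> rR}) n'
    (A : 'M[aR]_n'.+1) k :
  map_mx phi (krylov A k) = krylov (map_mx phi A) k.
Proof.
apply/matrixP=> i j; rewrite [LHS]mxE [X in phi X]mxE [RHS]mxE.
by rewrite -(map_polyXn phi) -map_kry [RHS]mxE.
Qed.

Lemma walk_mxE n' (A : 'M[rat]_n'.+1) : walk_mx A = krylov A n'.+1.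
Proof. by apply/matrixP=> i j; rewrite [LHS]mxE [RHS]mxE kryXn. Qed.

Lemma scalemxI (R : idomainType) m k (c : R) : c != 0 ->
  injective ( *:%R c : 'M_(m, k) -> 'M_(m, k)).
Proof.
move=> nz_c A B eAB; apply/matrixP=> i j; apply: (mulfI nz_c).
by move/matrixP/(_ i j): eAB; rewrite !mxE.
Qed.

(** * Reduction modulo a prime and lifting back to the integers *)

Section ModP.
Variable p : nat.
Hypothesis p_pr : prime p.
Local Notation F := 'F_p.

Lemma intr_Fp_eq0 (z : int) : (z%:~R == 0 :> F) = (p %| z)%Z.
Proof. by rewrite (dvdz_pcharf (pchar_Fp p_pr)). Qed.

Lemma p_neq0 : p%:Z != 0.
Proof. by case: p p_pr. Qed.

Lemma Euclid_dvdzM (a b : int) : (p %| a * b)%Z = (p %| a)%Z || (p %| b)%Z.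
Proof. by rewrite -!intr_Fp_eq0 rmorphM mulf_eq0. Qed.

Lemma map_intr_Fp_eq0 m k (A : 'M[int]_(m, k)) :
  map_mx (intr : int -> F) A = 0 -> exists B, A = p%:Z *: B.
Proof.
move=> A0; exists (map_mx (fun z => (z %/ p)%Z) A).
apply/matrixP=> i j; rewrite !mxE mulrC divzK // -intr_Fp_eq0.
by move/matrixP/(_ i j): A0; rewrite !mxE => ->.
Qed.

Lemma map_intr_FpM m k (B : 'M[int]_(m, k)) :
  map_mx (intr : int -> F) (p%:Z *: B) = 0.
Proof.
apply/matrixP=> i j; rewrite !mxE; apply/eqP; rewrite intr_Fp_eq0.
exact: dvdz_mulr.
Qed.

(** The coefficients are the representatives between 0 and [p - 1]. Hence degree and monicity
    survive the lift, and for [p = 2] every coefficient is 0 or 1, on which the computation modulo 4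
    relies. *)
Definition lift_Fp (f : {poly F}) : {poly int} := \poly_(i < size f) ((f`_i)%R : nat)%:Z.

Lemma lift_FpK f : map_poly (intr : int -> F) (lift_Fp f) = f.
Proof.
apply/polyP=> i; rewrite coef_map coef_poly.
by case: ltnP => [_|/(nth_default 0)->]; [exact: natr_Zp | by []].
Qed.

Lemma size_lift_Fp f : size (lift_Fp f) = size f.
Proof.
case: (posnP (size f)) => [s0|s_gt0]; first by apply/eqP; rewrite eqn_leq size_poly s0.
apply: size_poly_eq; rewrite -/(lead_coef f).
have : lead_coef f != 0 by rewrite lead_coef_eq0 -size_poly_gt0.
by apply: contraNneq => /(congr1 absz) /= f0; rewrite -[lead_coef f]natr_Zp f0.
Qed.

Lemma monic_lift_Fp f : f \is monic -> lift_Fp f \is monic.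
Proof.
move=> /monicP f1; apply/monicP; rewrite /lead_coef size_lift_Fp coef_poly.
have sf : (0 < size f)%N by rewrite size_poly_gt0 -lead_coef_eq0 f1 oner_eq0.
rewrite ltn_predL sf -/(lead_coef f) f1 /=.
by rewrite modn_small //; rewrite Fp_cast // prime_gt1.
Qed.

Section Structure.
Variables (n' : nat) (S : 'M[int]_n'.+1).
Local Notation n := n'.+1.
Local Notation Sb := (map_mx (intr : int -> F) S).

(** [mu] lifts the minimal polynomial of the all-one vector e under [S] modulo [p], so [d] is the
    dimension of the Krylov space modulo [p]. Cayley-Hamilton provides a monic relation of degree
    [n]; at the least possible degree, a nonzero relation of smaller degree is excluded because it
    could be made monic. *)
Lemma min_annihilator : exists (d : nat) (mu : {poly int}) (y : 'cV[int]_n),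
  [/\ mu \is monic, size mu = d.+1, (d <= n)%N, kry S mu = p%:Z *: y &
      forall f : {poly F}, (size f <= d)%N -> kry Sb f = 0 -> f = 0].
Proof.
pose P k := [exists r : 'rV[F]_k, kry Sb ('X^k + rVpoly r) == 0].
have Pn : P n.
  apply/existsP; exists (poly_rV (char_poly Sb - 'X^n)).
  have mon := char_poly_monic Sb; have sz := size_char_poly Sb.
  rewrite poly_rV_K; last first.
    apply/leq_sizeP=> j le_nj; rewrite coefB coefXn.
    case: eqVneq => [->|ne_jn]; last first.
      by rewrite subr0 nth_default // sz ltn_neqAle eq_sym ne_jn.
    by move/monicP: mon; rewrite /lead_coef sz /= => ->; rewrite subrr.
  by rewrite addrC subrK /kry Cayley_Hamilton mul0mx.
have exP : exists k, P k by exists n.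
case: (ex_minnP exP) => d /existsP[r /eqP kr0] min_d.
pose mub := 'X^d + rVpoly r.
have szr : (size (rVpoly r) < size ('X^d : {poly F}))%N by rewrite size_polyXn ltnS size_poly.
have mon : mub \is monic by apply/monicP; rewrite lead_coefDl ?lead_coefXn.
have [|y ey] := @map_intr_Fp_eq0 _ _ (kry S (lift_Fp mub)).
  by rewrite map_kry lift_FpK.
exists d, (lift_Fp mub), y; split=> //.
- exact: monic_lift_Fp.
- by rewrite size_lift_Fp size_polyDl // size_polyXn.
- exact: min_d.
move=> f szf f0; apply/eqP; apply: contraLR szf => nz_f; rewrite -ltnNge.
suff /min_d : P (size f).-1 by rewrite -ltnS prednK ?size_poly_gt0.
have nz_l : lead_coef f != 0 by rewrite lead_coef_eq0.
pose g := (lead_coef f)^-1 *: f.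
apply/existsP; exists (poly_rV (g - 'X^((size f).-1))).
rewrite poly_rV_K; last first.
  apply/leq_sizeP=> j le_j; rewrite coefB coefXn coefZ.
  case: eqVneq => [->|ne_j]; first by rewrite -/(lead_coef f) mulVf ?subrr.
  rewrite nth_default ?mulr0 ?subr0 // -(prednK (_ : 0 < size f)%N) ?size_poly_gt0 //.
  by rewrite ltn_neqAle eq_sym ne_j.
by rewrite addrC subrK /g kryZ f0 scaler0.
Qed.

End Structure.
End ModP.

Lemma horner_mx_mul_sum (R : comNzRingType) n' (A : 'M[R]_n'.+1) (y : 'cV_n'.+1)
    (g : {poly R}) k :
  (size g <= k)%N -> horner_mx A g *m y = \sum_(i < k) g`_i *: (A ^+ i *m y).
Proof.
move=> szg; have {1}-> : g = \sum_(i < k) g`_i *: 'X^i.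
  rewrite -poly_def; apply/polyP=> i; rewrite coef_poly.
  by case: ltnP => // /(leq_trans szg)/(nth_default 0).
rewrite raddf_sum mulmx_suml; apply: eq_bigr => i _.
by rewrite /= horner_mxZ horner_mxXn scalemxAl.
Qed.

(** * Completing the first Krylov vectors to a basis *)

Section Basis.
Variables (R : comNzRingType) (n' : nat) (S : 'M[R]_n'.+1) (d : nat).
Local Notation n := n'.+1.
Hypothesis le_dn : (d <= n)%N.
Implicit Types f g : {poly R}.

(** When mu(S) e = c y, these are the columns that remain of the walk matrix after monic column
    operations and division of the last [n - d] columns by c. *)
Definition kry_basis (y : 'cV[R]_n) : 'M[R]_n :=
  \matrix_(i, j) (if (j < d)%N then kry S 'X^j else S ^+ (j - d) *m y) i 0.

Definition basis_coords (f g : {poly R}) : 'cV[R]_n :=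
  \col_j (if (j < d)%N then f`_j else g`_(j - d)).

Lemma kry_basis_mul y f g : (size f <= d)%N -> (size g <= n - d)%N ->
  kry_basis y *m basis_coords f g = kry S f + horner_mx S g *m y.
Proof.
move=> szf szg; rewrite {1}/kry (horner_mx_mul_sum _ _ szf) (horner_mx_mul_sum _ _ szg).
apply/colP=> i; rewrite mxE.
pose h k := (if (k < d)%N then f`_k *: kry S 'X^k else g`_(k - d) *: (S ^+ (k - d) *m y)).
transitivity (\sum_(j < n) h j i 0).
  by apply: eq_bigr => j _; rewrite /h !mxE; case: ifP => _; rewrite [RHS]mxE mulrC.
rewrite -(big_mkord xpredT (fun k => h k i 0)) (big_cat_nat (n := d)) //=.
rewrite [RHS]mxE; congr (_ + _).
  rewrite big_mkord summxE; apply: eq_bigr => k _.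
  by rewrite /h ltn_ord kryXn.
rewrite -{1}[d]add0n big_addn big_mkord summxE; apply: eq_bigr => k _.
by rewrite /h ltnNge leq_addl /= addnK.
Qed.

Lemma basis_coords_eq0 f g : (size f <= d)%N -> (size g <= n - d)%N ->
  basis_coords f g = 0 -> f = 0 /\ g = 0.
Proof.
move=> szf szg /colP c0; split; apply/polyP=> i; rewrite coef0.
  case: (ltnP i d) => [lt_id|le_di]; last by rewrite nth_default // (leq_trans szf).
  by move: (c0 (Ordinal (leq_trans lt_id le_dn))); rewrite !mxE /= lt_id.
case: (ltnP i (n - d)) => [lt_id|le_di]; last by rewrite nth_default // (leq_trans szg).
have lt_n : (i + d < n)%N by rewrite addnC -ltn_subRL.
by move: (c0 (Ordinal lt_n)); rewrite !mxE /= ltnNge leq_addl /= addnK.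
Qed.

Lemma basis_coordsP (c : 'cV[R]_n) : exists f g : {poly R},
  [/\ (size f <= d)%N, (size g <= n - d)%N & c = basis_coords f g].
Proof.
exists (\poly_(i < d) c (inord i) 0), (\poly_(i < n - d) c (inord (i + d)) 0).
split; rewrite ?size_poly //; apply/colP=> j; rewrite mxE.
case: ifP => [lt_jd|/negbT]; first by rewrite coef_poly lt_jd inord_val.
rewrite -leqNgt => le_dj; rewrite coef_poly ltn_sub2rE // ltn_ord.
by rewrite subnK // inord_val.
Qed.

Section Annihilator.
Variables (mu : {poly R}) (c : R) (y : 'cV[R]_n).
Hypotheses (mon_mu : mu \is monic) (sz_mu : size mu = d.+1) (mu_y : kry S mu = c *: y).

(** Monic of degree [j] in both cases, so the coefficient matrix [U] is unitriangular. *)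
Let b (j : nat) : {poly R} := if (j < d)%N then 'X^j else 'X^(j - d) * mu.

Let size_b j : size (b j) = j.+1.
Proof.
rewrite /b; case: ltnP => [_|le_dj]; first by rewrite size_polyXn.
by rewrite mulrC size_mulXn ?monic_neq0 // sz_mu addnS subnK.
Qed.

Let b_top j : (b j)`_j = 1.
Proof.
suff /monicP : b j \is monic by rewrite /lead_coef size_b.
by rewrite /b; case: ifP => _; rewrite ?monicXn // rpredM ?monicXn.
Qed.

Let U : 'M[R]_n := \matrix_(i, j) (b j)`_i.
Let D (u v : R) : 'M[R]_n := diag_mx (\row_j if (j < d)%N then u else v).

Let krylovU : krylov S n *m U = kry_basis y *m D 1 c.
Proof.
apply/matrixP=> i j; rewrite mul_mx_diag !mxE.
transitivity (kry S (b j) i 0).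
  rewrite (@kry_krylov _ _ _ n) ?size_b // mxE; apply: eq_bigr => k _.
  by rewrite [U k j]mxE [_^T k 0]mxE [poly_rV _ _ _]mxE.
rewrite /b; case: ifP => _; first by rewrite mulr1.
by rewrite kryM mu_y horner_mxXn -scalemxAr mxE mulrC.
Qed.

Lemma det_krylov : \det (krylov S n) = \det (kry_basis y) * c ^+ (n - d).
Proof.
have <- : \det U = 1 -> \det (krylov S n) * \det U = \det (krylov S n) by move->; rewrite mulr1.
  rewrite -det_mulmx krylovU det_mulmx det_diag; congr (_ * _).
  transitivity (\prod_(0 <= j < n) (if (j < d)%N then 1 else c)).
    by rewrite big_mkord; apply: eq_bigr => j _; rewrite mxE.
  rewrite (big_cat_nat (n := d)) //= big_nat big1 ?mul1r => [|j /andP[_ ->]] //.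
  rewrite big_nat (eq_bigr (fun=> c)) => [|j /andP[]]; last by rewrite leqNgt => /negbTE->.
  by rewrite -big_nat prodr_const_nat.
rewrite -det_tr det_trig; first by rewrite big1 // => j _; rewrite !mxE b_top.
by apply/is_trig_mxP => i j lt_ij; rewrite !mxE nth_default // size_b.
Qed.

(** The determinant carries [c ^+ (n - d)], but a single factor [c] suffices as a denominator,
    because [D 1 c *m D c 1] is the scalar matrix [c]. This is what limits the power of [p] in a
    level. *)
Lemma krylov_quasi_inverse : exists C, krylov S n *m C = (c * \det (kry_basis y))%:M.
Proof.
exists (U *m D c 1 *m \adj (kry_basis y)); rewrite 2!mulmxA krylovU -(mulmxA _ (D 1 c)).
have -> : D 1 c *m D c 1 = c%:M.
  rewrite mulmx_diag -diag_const_mx; congr diag_mx; apply/rowP=> j.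
  by rewrite !mxE; case: ifP; rewrite ?mul1r ?mulr1.
by rewrite mul_mx_scalar -scalemxAl mul_mx_adj scale_scalar_mx.
Qed.

End Annihilator.
End Basis.

Lemma map_kry_basis (aR rR : comNzRingType) (phi : {rmorphism aR -> rR}) n'
    (A : 'M[aR]_n'.+1) d y :
  map_mx phi (kry_basis A d y) = kry_basis (map_mx phi A) d (map_mx phi y).
Proof.
apply/matrixP=> i j; rewrite [LHS]mxE [X in phi X]mxE [RHS]mxE.
case: ifP => _; first by rewrite -(map_polyXn phi) -map_kry [RHS]mxE.
by rewrite -rmorphXn -map_mxM [RHS]mxE.
Qed.

(** * Skew-symmetry and the prime 2 *)

Section Dot.
Variables (R : comNzRingType) (n : nat).
Implicit Types u v w : 'cV[R]_n.

Definition dot u v : R := (u^T *m v) 0 0.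

Lemma dotC u v : dot u v = dot v u.
Proof. by rewrite /dot !mxE; apply: eq_bigr => i _; rewrite !mxE mulrC. Qed.

Lemma dotDr u v w : dot u (v + w) = dot u v + dot u w.
Proof. by rewrite /dot mulmxDr mxE. Qed.

Lemma dotDl u v w : dot (u + v) w = dot u w + dot v w.
Proof. by rewrite ![dot _ w]dotC dotDr. Qed.

Lemma dotZr u c v : dot u (c *: v) = c * dot u v.
Proof. by rewrite /dot -scalemxAr mxE. Qed.

Lemma dotZl u c v : dot (c *: u) v = c * dot u v.
Proof. by rewrite ![dot _ v]dotC dotZr. Qed.

Lemma dot0r u : dot u 0 = 0.
Proof. by rewrite /dot mulmx0 mxE. Qed.

Lemma dot_mull (A : 'M_n) u v : dot (A *m u) v = dot u (A^T *m v).
Proof. by rewrite /dot trmx_mul mulmxA. Qed.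

Lemma mul_trmx_dot m k (A : 'M[R]_(n, m)) (B : 'M[R]_(n, k)) i j :
  (A^T *m B) i j = dot (col i A) (col j B).
Proof. by rewrite /dot !mxE; apply: eq_bigr => l _; rewrite !mxE. Qed.

Lemma mul_trmx_dotl m (A : 'M[R]_(n, m)) v i : (A^T *m v) i 0 = dot (col i A) v.
Proof. by rewrite mul_trmx_dot; congr dot; apply/colP=> j; rewrite mxE. Qed.

End Dot.

Lemma map_dot (aR rR : comNzRingType) (phi : {rmorphism aR -> rR}) n (u v : 'cV[aR]_n) :
  phi (dot u v) = dot (map_mx phi u) (map_mx phi v).
Proof. by rewrite /dot map_trmx -map_mxM [RHS]mxE. Qed.

Lemma col_krylov (R : comNzRingType) n' (S : 'M[R]_n'.+1) k (j : 'I_k) :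
  col j (krylov S k) = kry S 'X^j.
Proof. by apply/colP=> i; rewrite mxE [LHS]mxE. Qed.

Section Skew.
Variables (R : comNzRingType) (n' : nat) (S : 'M[R]_n'.+1).
Hypothesis skew : S^T = - S.
Implicit Types f g : {poly R}.

Local Notation e := (const_mx 1 : 'cV[R]_n'.+1).

Lemma trmx_horner_skew f : (horner_mx S f)^T = horner_mx S (f \Po (- 'X)).
Proof.
elim/poly_ind: f => [|f c IHf]; first by rewrite comp_poly0 !raddf0.
rewrite comp_poly_MXaddC !rmorphD !rmorphM /= rmorphN /= !horner_mx_C horner_mx_X.
rewrite raddfD /= tr_scalar_mx [_ * S]/(mulmx _ S) trmx_mul IHf skew.
rewrite mulNmx mulrN; congr (- _ + _); apply/esym/comm_horner_mx; exact: (erefl (S *m S)).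
Qed.

Lemma dot_hornerl f u v : dot (horner_mx S f *m u) v = dot u (horner_mx S (f \Po (- 'X)) *m v).
Proof. by rewrite dot_mull trmx_horner_skew. Qed.

Lemma dot_kry f v : dot (kry S f) v = dot e (horner_mx S (f \Po (- 'X)) *m v).
Proof. exact: dot_hornerl. Qed.

Lemma comp_Xn_oppX k : 'X^k \Po (- 'X) = (-1) ^+ k *: 'X^k :> {poly R}.
Proof. by rewrite comp_Xn_poly (exprNn 'X) -mul_polyC polyC_exp polyCN. Qed.

(** Moving S^k across the form costs only a sign, so Gram matrices of Krylov vectors depend only on
    the walk counts e^T S^k e. *)
Lemma dot_kryXn k f : dot (kry S 'X^k) (kry S f) = (-1) ^+ k * dot e (kry S ('X^k * f)).
Proof. by rewrite dot_kry -kryM comp_Xn_oppX -scalerAl kryZ dotZr. Qed.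
End Skew.

Lemma dvdz2_sqrD (x : int) : (2 %| x * x + x)%Z.
Proof.
have [q [->|->]] : exists q : int, x = q * 2 \/ x = q * 2 + 1 by exists (x %/ 2)%Z; lia.
  by apply/dvdzP; exists (q * (q * 2 + 1)); ring.
by apply/dvdzP; exists ((q * 2 + 1) * (q + 1)); ring.
Qed.

Section SkewInt.
Variables (n' : nat) (S : 'M[int]_n'.+1).
Hypothesis skew : S^T = - S.
Implicit Types f g : {poly int}.
Local Notation n := n'.+1.
Local Notation e := (const_mx 1 : 'cV[int]_n'.+1).

Lemma mulXn_compX2 k f c :
  'X^k * ((f * 'X + c%:P) \Po 'X^2) = 'X^(k.+2) * (f \Po 'X^2) + c *: 'X^k.
Proof. by rewrite comp_poly_MXaddC -mul_polyC !exprS; ring. Qed.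

(** For odd [k] the matrix S^k f(S^2) is skew, so its quadratic form vanishes. *)
Lemma dot_one_odd k f : odd k -> dot e (kry S ('X^k * (f \Po 'X^2))) = 0.
Proof.
elim/poly_ind: f k => [|f c IHf] k odd_k; first by rewrite comp_poly0 mulr0 kry0 dot0r.
rewrite mulXn_compX2 kryD dotDr IHf /= ?negbK // add0r kryZ dotZr.
suff -> : dot e (kry S 'X^k) = 0 by rewrite mulr0.
have := dot_kryXn skew k 1; rewrite mulr1 kry1 dotC -signr_odd odd_k expr1 mulN1r.
by set a := dot e _; clearbody a; lia.
Qed.

(** Odd exponents give 0. For exponent 2i with i > 0 the value is, up to sign, the norm of S^i e,
    which has the parity of e^T S^i e since x^2 and x have the same parity; strong induction
    concludes. *)
Lemma dot_one_even k : (2 %| dot e (kry S 'X^(k.+1)))%Z.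
Proof.
have [m] := ubnP k; elim: m k => // m IHm k; rewrite ltnS => le_km.
case odd_k: (odd k.+1).
  by have := dot_one_odd 1 odd_k; rewrite comp_polyC mulr1 => ->.
have [j ek] : exists j, k.+1 = (j.+1 + j.+1)%N.
  exists k./2; have := odd_double_half k.+1; rewrite odd_k /= uphalf_half.
  by move: odd_k => /= /negbFE->; lia.
have := dot_kryXn skew j.+1 'X^(j.+1); rewrite -exprD -ek => edot.
have : (2 %| dot (kry S 'X^(j.+1)) (kry S 'X^(j.+1)) + dot e (kry S 'X^(j.+1)))%Z.
  rewrite /dot !mxE -big_split /=; apply: rpred_sum => i _.
  by rewrite !mxE mul1r; exact: dvdz2_sqrD.
have lt_jm : (j < m)%N by lia.
have := IHm j lt_jm; rewrite edot -signr_odd.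
set a := dot e _; set b := dot e _; clearbody a b.
by case: (odd j.+1); rewrite ?expr0 ?expr1 ?mul1r ?mulN1r; lia.
Qed.

Lemma dot_one_kryXM_even k f : (2 %| dot e (kry S ('X^(k.+1) * f)))%Z.
Proof.
elim/poly_ind: f k => [|f c IHf] k; first by rewrite mulr0 kry0 dot0r.
have -> : 'X^(k.+1) * (f * 'X + c%:P) = 'X^(k.+2) * f + c *: 'X^(k.+1).
  by rewrite -mul_polyC !exprS; ring.
by rewrite kryD dotDr kryZ dotZr rpredD ?IHf // dvdz_mull ?dot_one_even.
Qed.

(* Expanding the left-hand form, the cross terms cancel modulo 4 by skewness, and the
   squares of the coefficients reduce to the coefficients themselves. *)
Lemma dot_kry_quad_step k f c : ~~ odd k ->
  (4 %| dot (kry S f) (kry S ('X^(k.+2) * f)) - dot e (kry S ('X^(k.+2) * (f \Po 'X^2))))%Z ->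
  (4 %| (c * c - c) * dot e (kry S 'X^k))%Z ->
  (4 %| dot (kry S (f * 'X + c%:P)) (kry S ('X^k * (f * 'X + c%:P)))
        - dot e (kry S ('X^k * ((f * 'X + c%:P) \Po 'X^2))))%Z.
Proof.
move=> ev_k.
rewrite mulXn_compX2 [kry S (_ + _ *: _)]kryD dotDr kryZ dotZr.
have -> : 'X^k * (f * 'X + c%:P) = 'X^(k.+1) * f + c *: 'X^k.
  by rewrite -mul_polyC !exprS; ring.
rewrite [f * 'X]mulrC -[c%:P]mulr1 mul_polyC !kryD !kryZ kry1 !(dotDl, dotDr, dotZl, dotZr).
have -> : dot (kry S ('X * f)) (kry S ('X^(k.+1) * f)) = - dot (kry S f) (kry S ('X^(k.+2) * f)).
  rewrite kryXM dot_mull skew mulNmx -scaleN1r dotZr mulN1r -kryXM mulrA -exprS //.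
have -> : dot (kry S ('X * f)) (kry S 'X^k) = dot e (kry S ('X^(k.+1) * f)).
  by rewrite dotC dot_kryXn // -signr_odd (negbTE ev_k) expr0 mul1r mulrA -exprSr.
have := dot_one_kryXM_even k f; have := dot_one_kryXM_even k.+1 (f \Po 'X^2).
set u := dot e _; set v := dot e _; set w := dot e _; set z := dot _ _.
clearbody u v w z.
move=> /dvdzP[u' ->] /dvdzP[v' ->] /dvdzP[z' ez] /dvdzP[w' ew].
(* Skewness has turned [z] into its opposite. This is harmless: [z] is even, being congruent modulo
   4 to an even number, so [z] and [- z] agree modulo 4. *)
have {ez} -> : z = z' * 4 + u' * 2 by rewrite -ez; ring.
apply/dvdzP; exists (w' - z' - u' + c * v').
by apply: subr0_eq; rewrite -(subrr (w' * 4)) -{1}ew; ring.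
Qed.

(** With a positive exponent e^T S^(k+2) e is even, and so is c^2 - c; their product vanishes modulo
    4 whatever the coefficient c. *)
Lemma dot_kry_quad_pos k f : ~~ odd k ->
  (4 %| dot (kry S f) (kry S ('X^(k.+2) * f)) - dot e (kry S ('X^(k.+2) * (f \Po 'X^2))))%Z.
Proof.
elim/poly_ind: f k => [|f c IHf] k ev_k; first by rewrite comp_poly0 !mulr0 kry0 !dot0r.
have even_c : (2 %| c * c - c)%Z by have := dvdz2_sqrD c; set x := c * c; clearbody x; lia.
have dv : (4 %| (c * c - c) * dot e (kry S 'X^(k.+2)))%Z.
  exact: (dvdz_mul even_c (dot_one_even k.+1)).
by apply: dot_kry_quad_step; rewrite ?IHf /= ?negbK.
Qed.

(** For [k = 0] the number e^T e = n may be odd, so the constant coefficient has to satisfy c^2 = c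
    exactly. The other coefficients fall under [dot_kry_quad_pos]. *)
Lemma dot_kry_quad k f : ~~ odd k -> (f`_0 == 0) || (f`_0 == 1) ->
  (4 %| dot (kry S f) (kry S ('X^k * f)) - dot e (kry S ('X^k * (f \Po 'X^2))))%Z.
Proof.
elim/poly_ind: f => [|f c _] ev_k; first by rewrite comp_poly0 !mulr0 kry0 !dot0r.
rewrite coefD coefMX coefC /= add0r => c01.
have cc : c * c - c = 0 by case/orP: c01 => /eqP->.
by apply: dot_kry_quad_step; rewrite ?cc ?mul0r ?dot_kry_quad_pos.
Qed.

End SkewInt.

Lemma rank_krylov (K : fieldType) n' (A : 'M[K]_n'.+1) d :
  (forall f : {poly K}, (size f <= d)%N -> kry A f = 0 -> f = 0) ->
  \rank (krylov A d) = d.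
Proof.
move=> min_d; rewrite -mxrank_tr; apply/eqP; apply: inj_row_free => v v0.
rewrite -[v](@rVpolyK _ d).
suff -> : rVpoly v = 0 by rewrite raddf0.
apply: min_d; first exact: size_poly.
by rewrite -[v]trmxK -krylov_mul -[krylov A d]trmxK -trmx_mul v0 trmx0.
Qed.

(** * The Krylov space modulo 2 *)

Section ModTwo.
Variables (n' : nat) (S : 'M[int]_n'.+1) (z : int).
Local Notation n := n'.+1.
Local Notation Sb := (map_mx (intr : int -> 'F_2) S).
Local Notation e := (const_mx 1 : 'cV[int]_n'.+1).
Hypothesis skew : S^T = - S.
Hypothesis det_krylov2 : \det (krylov S n) = 2 ^+ n./2 * z.
Hypothesis odd_z : ~~ (2 %| z)%Z.
Variables (d : nat) (mu : {poly int}) (y : 'cV[int]_n).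
Hypotheses (mon_mu : mu \is monic) (sz_mu : size mu = d.+1) (le_dn : (d <= n)%N).
Hypothesis mu_y : kry S mu = 2%:Z *: y.
Hypothesis min_d : forall f : {poly 'F_2}, (size f <= d)%N -> kry Sb f = 0 -> f = 0.

Let E := krylov Sb d.

(** Up to sign the Gram entries are e^T S^(i+j) e, even unless i = j = 0, where the entry is [n]. *)
Lemma rank_krylov_gram_mod2 : (\rank (E^T *m E) <= odd n)%N.
Proof.
pose u : 'cV['F_2]_d := \col_i ((i : nat) == 0%N)%:R.
have -> : E^T *m E = u *m (n%:R *: u^T).
  apply/matrixP=> i j; rewrite mul_trmx_dot !col_krylov.
  rewrite -![in LHS](map_polyXn (intr : int -> 'F_2)) -!map_kry -map_dot dot_kryXn //.
  rewrite -exprD rmorphM /=.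
  have -> : (u *m (n%:R *: u^T)) i j = ((i + j)%N == 0%N)%:R * n%:R.
    rewrite mxE big_ord1 !mxE addn_eq0.
    by case: (_ == _); case: (_ == _); rewrite ?mul0r ?mulr0 ?mul1r ?mulr1.
  case: eqP => [ij0|/eqP]; last first.
    rewrite -lt0n; case: (_ + _)%N => // k _; rewrite mul0r.
    by have := dot_one_even skew k; rewrite -(@intr_Fp_eq0 2) // => /eqP ->; rewrite mulr0.
  rewrite ij0; have -> : (i : nat) = 0%N by lia.
  rewrite kry1 !mul1r /dot mxE rmorph_sum.
  rewrite (eq_bigr (fun=> 1)) => [|k _]; first by rewrite sumr_const card_ord.
  by rewrite !mxE.
have [on|en] := boolP (odd n).
  by rewrite (leq_trans (mxrankM_maxr _ _)) // rank_leq_row.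
suff -> : n%:R = 0 :> 'F_2 by rewrite scale0r mulmx0 mxrank0.
by apply/eqP; have := intr_Fp_eq0 (isT : prime 2) n => ->; rewrite dvdzE /= dvdn2.
Qed.

(** Upper bound: 2^(n-d) divides the determinant, whose 2-part is 2^(n./2). Lower bound: the radical
    of the Krylov space has dimension at least [d - odd n] and lies in the orthogonal complement, of
    dimension [n - d]. *)
Lemma krylov_codim_mod2 : (n - d)%N = n./2.
Proof.
have := mxrank_mul_ker E^T E; rewrite mxrank_tr rank_krylov // => rk.
have : (\rank (E^T :&: kermx E)%MS <= n - d)%N.
  by rewrite (leq_trans (mxrankS (capmxSr _ _))) // mxrank_ker rank_krylov.
have : (n - d <= n./2)%N.
  rewrite leqNgt; apply: contra odd_z => lt_h.
  move: det_krylov2; rewrite (det_krylov le_dn mon_mu sz_mu mu_y) -(subnK lt_h) addnS exprS exprD.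
  move=> eq2; apply/dvdzP; exists (\det (kry_basis S d y) * 2 ^+ (n - d - (n./2).+1)).
  have nz : 2%:Z ^+ n./2 != 0 by rewrite expf_neq0.
  by apply: (mulfI nz); rewrite -eq2; ring.
move: rk rank_krylov_gram_mod2; set a := \rank (_ *m _); set b := \rank (_ :&: _)%MS.
clearbody a b => <-.
have := odd_double_half n; lia.
Qed.

Lemma odd_det_kry_basis : ~~ (2 %| \det (kry_basis S d y))%Z.
Proof.
apply: contra odd_z => /dvdzP[q eq].
move: det_krylov2; rewrite (det_krylov le_dn mon_mu sz_mu mu_y).
rewrite krylov_codim_mod2 eq mulrC => /mulfI.
by move=> <-; [apply: dvdz_mull | rewrite expf_neq0].
Qed.

(** The orthogonal complement of the Krylov space has dimension [n./2], already attained by the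
    radical; so the complement is the radical and lies in the Krylov space. *)
Lemma krylov_orth_mod2 (v : 'cV['F_2]_n) : E^T *m v = 0 ->
  exists2 f : {poly 'F_2}, (size f <= d)%N & v = kry Sb f.
Proof.
move=> v0; have rkE : \rank E = d by exact: rank_krylov.
have rk := mxrank_mul_ker E^T E; rewrite mxrank_tr rkE in rk.
have cap_le : (\rank (kermx E) <= \rank (E^T :&: kermx E))%N.
  rewrite mxrank_ker rkE.
  move: rk rank_krylov_gram_mod2 le_dn krylov_codim_mod2 (odd_double_half n).
  by set a := \rank (_ *m _); set b := \rank (_ :&: _)%MS; clearbody a b; lia.
have := mxrank_leqif_sup (capmxSr E^T (kermx E)).
move=> [le_r eq_r]; have : (kermx E <= E^T :&: kermx E)%MS by rewrite -eq_r eqn_leq le_r.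
rewrite sub_capmx => /andP[kerE _].
have : (v^T <= E^T)%MS.
  apply: submx_trans kerE; apply/sub_kermxP.
  by rewrite -[E]trmxK -trmx_mul v0 trmx0.
case/submxP=> h eh; exists (rVpoly h); first exact: size_poly.
by rewrite -[h]trmxK -krylov_mul -[v]trmxK eh trmx_mul trmxK.
Qed.

(** Transposing the quasi-inverse identity recovers [w], multiplied by 2 and an odd determinant,
    from its products with the Krylov vectors; if these are divisible by 4, one factor 2 remains for
    [w]. *)
Lemma dvd2_of_dot_krylov (w : 'cV[int]_n) :
  (forall k, (4 %| dot (kry S 'X^k) w)%Z) -> exists w', w = 2%:Z *: w'.
Proof.
move=> dvd_w; have [C eC] := krylov_quasi_inverse mon_mu sz_mu mu_y.
have [v ev] : exists v, (krylov S n)^T *m w = 4%:Z *: v.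
  exists (\col_k (dot (kry S 'X^k) w %/ 4)%Z); apply/colP=> k.
  by rewrite mul_trmx_dotl col_krylov [RHS]mxE [X in _ * X]mxE mulrC divzK.
have : 2%:Z *: (\det (kry_basis S d y) *: w) = 2%:Z *: (2%:Z *: (C^T *m v)).
  have := congr1 (fun M => M^T *m w) eC.
  by rewrite trmx_mul -mulmxA ev -scalemxAr tr_scalar_mx mul_scalar_mx !scalerA => <-.
move=> /(scalemxI (isT : 2%:Z != 0)) eB.
apply: (@map_intr_Fp_eq0 2) => //; apply/colP=> i; rewrite !mxE; apply/eqP.
rewrite (@intr_Fp_eq0 2) //; move/colP/(_ i): eB; rewrite !mxE => eB.
have : (2 %| \det (kry_basis S d y) * w i ord0)%Z by rewrite eB dvdz_mulr.
by rewrite (@Euclid_dvdzM 2) // (negbTE odd_det_kry_basis).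
Qed.

(* Modulo 2 the vector [x] is some [f(S) e], and isotropy modulo 4 turns into
   [e^T S^k f(S^2) e = 0] modulo 4 for all [k]. Over F_2 this says that [f(X)^2 = f(X^2)] is
   divisible by [mu], with a quotient [q] such that [q(S) y] lies in the Krylov space; hence
   [q = 0] by its degree. *)
Lemma krylov_isotropic_mod2 (x : 'cV[int]_n) :
  (forall k, (4 %| dot x (S ^+ k *m x))%Z) ->
  (forall k, (2 %| dot (kry S 'X^k) x)%Z) ->
  map_mx (intr : int -> 'F_2) x = 0.
Proof.
move=> x4 x2.
have [f szf ef] : exists2 f : {poly 'F_2}, (size f <= d)%N & map_mx intr x = kry Sb f.
  apply: krylov_orth_mod2; apply/colP=> i; rewrite mul_trmx_dotl mxE col_krylov.
  rewrite -(map_polyXn (intr : int -> 'F_2)) -map_kry.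
  by rewrite -map_dot; apply/eqP; rewrite (@intr_Fp_eq0 2).
pose g := lift_Fp f.
have [be ebe] : exists be, x - kry S g = 2%:Z *: be.
  by apply: (@map_intr_Fp_eq0 2); rewrite // map_mxB map_kry lift_FpK // ef subrr.
have g01 : (g`_0 == 0) || (g`_0 == 1).
  rewrite coef_poly; case: ifP => // _.
  by case: (f`_0)%R => [[|[|k]]].
pose w := kry S (g \Po 'X^2).
have w4 k : (4 %| dot (kry S 'X^k) w)%Z.
  rewrite dot_kryXn // dvdz_mull //.
  have [odd_k|ev_k] := boolP (odd k); first by rewrite dot_one_odd.
  have := dot_kry_quad skew ev_k g01; have := x4 k.
  have -> : x = kry S g + 2%:Z *: be by rewrite -ebe addrC subrK.
  rewrite mulmxDr -scalemxAr !(dotDl, dotDr, dotZl, dotZr).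
  (* For even [k] the matrix S^k is symmetric: the two cross terms coincide, and together they
     contribute a multiple of 4. *)
  have -> : dot be (S ^+ k *m kry S g) = dot (kry S g) (S ^+ k *m be).
    rewrite dotC -horner_mxXn dot_hornerl // comp_Xn_oppX.
    by rewrite -signr_odd (negbTE ev_k) expr0 scale1r.
  have -> : S ^+ k *m kry S g = kry S ('X^k * g) by rewrite kryM horner_mxXn.
  set a := dot _ _; set b := dot _ _; set c := dot _ _; set u := dot _ _.
  by clearbody a b c u; lia.
have [w' ew'] : exists w', w = 2%:Z *: w' by exact: dvd2_of_dot_krylov.
(* The products of [w] with the Krylov vectors are divisible by 4, so those of its half [w'] are
   even. *)
have [h szh eh] : exists2 h : {poly 'F_2}, (size h <= d)%N & map_mx intr w' = kry Sb h.
  apply: krylov_orth_mod2; apply/colP=> i; rewrite mul_trmx_dotl mxE col_krylov.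
  rewrite -(map_polyXn (intr : int -> 'F_2)) -map_kry.
  rewrite -map_dot; apply/eqP; rewrite (@intr_Fp_eq0 2) //.
  by have := w4 i; rewrite ew' dotZr; set a := dot _ _; clearbody a; lia.
pose q := Pdiv.Ring.rdivp (g \Po 'X^2) mu; pose r := Pdiv.Ring.rmodp (g \Po 'X^2) mu.
have eqr : g \Po 'X^2 = q * mu + r by exact: Pdiv.RingMonic.rdivp_eq.
have szr : (size r <= d)%N by rewrite -ltnS -sz_mu Pdiv.Ring.ltn_rmodp monic_neq0.
have ewr : w = 2%:Z *: (horner_mx S q *m y) + kry S r by rewrite /w eqr kryD kryM mu_y scalemxAr.
(* Since [w] is even, r(S) e vanishes modulo 2, and [r] has degree below [d]. *)
have r0 : map_poly (intr : int -> 'F_2) r = 0.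
  apply: min_d; first exact: leq_trans (size_poly _ _) szr.
  rewrite -map_kry -[kry S r](addKr (2%:Z *: (horner_mx S q *m y))) -ewr ew' addrC.
  by rewrite map_mxB !(@map_intr_FpM 2) ?subrr.
pose r2 := map_poly (fun c => (c %/ 2)%Z) r.
have er2 : r = 2%:Z *: r2.
  apply/polyP=> i; rewrite coefZ coef_map_id0 ?div0z // mulrC divzK //.
  by rewrite -(@intr_Fp_eq0 2) // -coef_map /= r0 coef0.
have ew2 : w' = horner_mx S q *m y + kry S r2.
  apply: (scalemxI (isT : 2%:Z != 0)).
  by rewrite -ew' ewr er2 kryZ scalerDr.
pose qb := map_poly (intr : int -> 'F_2) q.
have efq : f \Po 'X^2 = qb * map_poly intr mu.
  have := congr1 (map_poly (intr : int -> 'F_2)) eqr.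
  by rewrite rmorphD rmorphM /= r0 addr0 map_comp_poly map_polyXn lift_FpK.
have nz_mub : size (map_poly (intr : int -> 'F_2) mu) = d.+1.
  by rewrite size_map_poly_id0 // (monicP mon_mu).
have nz_mu : map_poly (intr : int -> 'F_2) mu != 0 by rewrite -size_poly_eq0 nz_mub.
(* f(X^2) has degree at most 2d - 2, so the quotient by [mu] has size at most d - 1. This is at most
   [n - d] because [n - d = n./2]. *)
have szq : (size qb <= n - d)%N.
  have [-> |nz_q] := eqVneq qb 0; first by rewrite size_poly0.
  have : (size qb + d <= ((size f).-1 * 2).+1)%N.
    have <- : size (qb * map_poly intr mu) = (size qb + d)%N.
      by rewrite (size_mul nz_q nz_mu) nz_mub addnS.
    by rewrite -efq; have := size_comp_poly_leq f 'X^2; rewrite size_polyXn.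
  have : (0 < size qb)%N by rewrite size_poly_gt0.
  move: szf le_dn krylov_codim_mod2 (odd_double_half n) (leq_b1 (odd n)).
  by set o := nat_of_bool _; set l := _./2; clearbody o l; lia.
(* Modulo 2 the columns of [kry_basis] are a basis, and q(S) y equals a Krylov vector, so the
   coordinates of q(S) y along the second block vanish. *)
have q0 : qb = 0.
  have unitB : kry_basis Sb d (map_mx intr y) \in unitmx.
    rewrite -map_kry_basis unitmxE det_map_mx unitfE (@intr_Fp_eq0 2) //.
    exact: odd_det_kry_basis.
  have := congr1 (map_mx (intr : int -> 'F_2)) ew2.
  rewrite map_mxD map_mxM map_horner_mx map_kry eh => eq_h.
  have szr2 : (size (map_poly (intr : int -> 'F_2) r2 - h)%R <= d)%N.
    rewrite (leq_trans (size_polyD _ _)) // size_polyN geq_max szh andbT.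
    by rewrite !(leq_trans (size_poly _ _)).
  have := kry_basis_mul Sb le_dn (map_mx intr y) szr2 szq.
  have -> : kry Sb (map_poly intr r2 - h) + horner_mx Sb qb *m map_mx intr y = 0.
    by rewrite kryB eq_h [X in _ - X]addrC opprD addrA subrr sub0r addNr.
  move=> /(congr1 (mulmx (invmx (kry_basis Sb d (map_mx intr y))))).
  by rewrite mulKmx // mulmx0 => /(basis_coords_eq0 le_dn szr2 szq)[].
move/eqP: efq; rewrite q0 mul0r comp_poly_eq0 ?size_polyXn // => /eqP f0.
by rewrite ef f0 kry0.
Qed.

End ModTwo.

(** * Odd primes *)

Lemma coef_comp_oppX (R : comNzRingType) (f : {poly R}) i :
  (f \Po (- 'X))`_i = (-1) ^+ i * f`_i.
Proof.
elim/poly_ind: f i => [|f c IHf] i; first by rewrite comp_poly0 !coef0 mulr0.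
rewrite comp_poly_MXaddC mulrN !(coefD, coefN, coefMX, coefC).
by case: i => [|i] /=; rewrite ?oppr0 ?expr0 ?mul1r // !addr0 IHf exprS mulN1r mulNr.
Qed.

Lemma size_comp_oppX (R : comNzRingType) (f : {poly R}) : (size (f \Po (- 'X)) <= size f)%N.
Proof. by apply/leq_sizeP=> j /(nth_default 0) f0; rewrite coef_comp_oppX f0 mulr0. Qed.

Section Anticommute.
Variables (R : comNzRingType) (n' : nat) (S V : 'M[R]_n'.+1) (m : R).
Hypothesis VS : V *m S = - (S *m V).

Lemma anticomm_horner f : V *m horner_mx S f = horner_mx S (f \Po (- 'X)) *m V.
Proof.
elim/poly_ind: f => [|f c IHf]; first by rewrite comp_poly0 rmorph0 mulmx0 mul0mx.
rewrite comp_poly_MXaddC !rmorphD !rmorphM /= rmorphN /= !horner_mx_C horner_mx_X.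
rewrite mulmxDr mulmxDl [_ * S]/(mulmx _ S) mulmxA IHf -mulmxA VS scalar_mxC.
by rewrite mulmxN mulrN mulNmx mulmxA.
Qed.

Hypothesis Ve : V *m const_mx 1 = m *: (const_mx 1 : 'cV_n'.+1).

Lemma anticomm_kry f : V *m kry S f = m *: kry S (f \Po (- 'X)).
Proof. by rewrite /kry mulmxA anticomm_horner -mulmxA Ve scalemxAr. Qed.
End Anticommute.

(** * The orthogonal line of the Krylov space modulo an odd prime *)

Section Odd.
Variables (p n' : nat) (S : 'M[int]_n'.+1).
Local Notation n := n'.+1.
Local Notation F := 'F_p.
Local Notation red := (map_mx (intr : int -> F)).
Local Notation Sb := (red S).
Hypothesis p_pr : prime p.
Hypothesis p_odd : odd p.
Variables (d : nat) (mu : {poly int}) (y : 'cV[int]_n).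
Hypotheses (mon_mu : mu \is monic) (sz_mu : size mu = d.+1) (dn : d = n').
Hypothesis mu_y : kry S mu = p%:Z *: y.
Hypothesis min_d : forall f : {poly F}, (size f <= d)%N -> kry Sb f = 0 -> f = 0.
Hypothesis unit_basis : ~~ (p %| \det (kry_basis S d y))%Z.

(** Multiplication by [p] identifies K^*/L with this space, K being the Krylov lattice, K^* its dual
    and L the standard lattice. As [d] is one less than the dimension, it is a line. *)
Definition orth_krylov (v : 'cV[F]_n) := forall f, dot (kry Sb f) v = 0.

Let two_neq0 : 2%:R != 0 :> F.
Proof.
have := intr_Fp_eq0 p_pr 2 => ->; rewrite dvdzE /= dvdn_divisors //.
by case: p p_pr p_odd => [|[|[|k]]].
Qed.

Let le_dn : (d <= n)%N. Proof. by rewrite dn. Qed.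

Let unitB : kry_basis Sb d (red y) \in unitmx.
Proof. by rewrite -map_kry_basis unitmxE det_map_mx unitfE intr_Fp_eq0. Qed.

(** Such a [v] is orthogonal to every vector of the basis [kry_basis]. Hence the product with [y] is
    an injective functional on the orthogonal space, which makes that space at most a line. *)
Lemma orth_krylov_eq0 v : orth_krylov v -> dot (red y) v = 0 -> v = 0.
Proof.
move=> ov yv; have : (kry_basis Sb d (red y))^T *m v = 0.
  apply/colP=> i; rewrite mul_trmx_dotl [RHS]mxE.
  have -> : col i (kry_basis Sb d (red y)) = if (i < d)%N then kry Sb 'X^i else red y.
    apply/colP=> j; rewrite [LHS]mxE [LHS]mxE; case: ifP => // /negbT; rewrite -leqNgt => le_di.
    have -> : (i - d = 0)%N by apply/eqP; rewrite subn_eq0 -ltnS dn ltn_ord.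
    by rewrite expr0 mul1mx.
  by case: ifP => _; rewrite ?ov.
move/(congr1 (mulmx (invmx (kry_basis Sb d (red y))^T))).
by rewrite mulKmx ?unitmx_tr // mulmx0.
Qed.

Lemma orth_krylov_line u v : orth_krylov u -> orth_krylov v -> u != 0 ->
  exists c, v = c *: u.
Proof.
move=> ou ov nz_u; have nz_yu : dot (red y) u != 0.
  by apply: contraNneq nz_u => /(orth_krylov_eq0 ou)->.
exists (dot (red y) v / dot (red y) u).
apply/eqP; rewrite -subr_eq0; apply/eqP/orth_krylov_eq0 => [f|].
  by rewrite -scaleNr dotDr dotZr ou ov mulr0 addr0.
by rewrite -scaleNr dotDr dotZr mulNr divfK // subrr.
Qed.

(** Write v = f(S) e + c y, the second block having a single vector. Then 0 = v.v = c (y.v), and y.v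
    is nonzero unless v = 0. *)
Lemma isotropic_orth_krylov v : orth_krylov v -> dot v v = 0 ->
  exists2 f : {poly F}, (size f <= d)%N & v = kry Sb f.
Proof.
move=> ov vv0; have [->|nz_v] := eqVneq v 0.
  by exists 0; rewrite ?size_poly0 ?kry0.
have [f [g [szf szg]]] := basis_coordsP d (invmx (kry_basis Sb d (red y)) *m v).
move/(congr1 (mulmx (kry_basis Sb d (red y)))); rewrite mulKVmx // kry_basis_mul // => ev.
exists f => //; rewrite ev.
have {szg} eg : g = (g`_0)%:P by apply: size1_polyC; move: szg; rewrite dn subSnn.
move: vv0; rewrite {1}ev dotDl ov add0r eg horner_mx_C mul_scalar_mx dotZl => /eqP.
rewrite mulf_eq0 => /orP[/eqP->|/eqP/(orth_krylov_eq0 ov) v0]; first by rewrite scale0r addr0.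
by rewrite v0 eqxx in nz_v.
Qed.

Lemma orth_krylov_lift (u v : 'cV[int]_n) :
  orth_krylov (red u) -> orth_krylov (red v) -> red u != 0 ->
  exists (a : int) (t : 'cV[int]_n), v = a *: u + p%:Z *: t.
Proof.
move=> ou ov nz_u; have [c ec] := orth_krylov_line ou ov nz_u.
pose a : int := (c : nat)%:Z.
have ea : a%:~R = c by exact: natr_Zp.
have [t et] : exists t, v - a *: u = p%:Z *: t.
  apply: (map_intr_Fp_eq0 p_pr); rewrite map_mxB ec -ea.
  by apply/colP=> i; rewrite !mxE /= intrM subrr.
by exists a, t; rewrite -et addrC subrK.
Qed.

(** With v = a u + p t and [a] prime to [p], comparing the norms shows that p^2 divides 2 a p (u.t).
    Since [p] is odd, it divides u.t, and so p^2 divides u.v. *)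
Lemma dot_line_sq u v : red u != 0 -> red v != 0 ->
  orth_krylov (red u) -> orth_krylov (red v) ->
  (p%:Z * p%:Z %| dot u u)%Z -> (p%:Z * p%:Z %| dot v v)%Z -> (p%:Z * p%:Z %| dot u v)%Z.
Proof.
move=> nz_u nz_v ou ov uu vv; have [a [t et]] := orth_krylov_lift ou ov nz_u.
have na : ~~ (p %| a)%Z.
  rewrite -intr_Fp_eq0 //; apply: contraNneq nz_v => a0; apply/eqP.
  rewrite et map_mxD map_intr_FpM // addr0; apply/colP=> i.
  by rewrite !mxE /= intrM a0 mul0r.
move/dvdzP: uu => [k ek]; have ut : (p %| dot u t)%Z.
  have : (p%:Z * p%:Z %| p%:Z * (2 * a * dot u t))%Z.
    have -> : p%:Z * (2 * a * dot u t) = dot v v - (a * a * k + dot t t) * (p%:Z * p%:Z).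
      rewrite et !(dotDl, dotDr, dotZl, dotZr) [dot t u]dotC ek; ring.
    by rewrite rpredB // dvdz_mull.
  rewrite dvdz_mul2l ?p_neq0 // !Euclid_dvdzM // (negbTE na) orbF.
  by rewrite -[(p %| 2)%Z]intr_Fp_eq0 // (negbTE two_neq0).
move/dvdzP: ut => [l el].
rewrite et dotDr !dotZr ek el; apply/dvdzP; exists (a * k + l); ring.
Qed.

(** Write v = a u + p t and w = b u + p s. The hypotheses force [p] to divide u.t and u.s, so every
    term of v.w is divisible by p^2. *)
Lemma dot_line_transfer u v w : red u != 0 ->
  orth_krylov (red u) -> orth_krylov (red v) -> orth_krylov (red w) ->
  (p%:Z * p%:Z %| dot u u)%Z -> (p%:Z * p%:Z %| dot u v)%Z ->
  (p%:Z * p%:Z %| dot u w)%Z -> (p%:Z * p%:Z %| dot v w)%Z.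
Proof.
move=> nz_u ou ov ow uu.
have [a [t ->]] := orth_krylov_lift ou ov nz_u.
have [b [s ->]] := orth_krylov_lift ou ow nz_u.
have cancel_p c x : (p%:Z * p%:Z %| c * dot u u + p%:Z * x)%Z -> (p %| x)%Z.
  move=> h; rewrite -(dvdz_mul2l (p_neq0 p_pr)) -(addKr (c * dot u u) (_ * x)).
  by rewrite rpredD // rpredN dvdz_mull.
rewrite !(dotDl, dotDr, dotZl, dotZr) [dot t u]dotC.
move=> /cancel_p/dvdzP[k ->] /cancel_p/dvdzP[l ->]; case/dvdzP: uu => m ->.
apply/dvdzP; exists (a * b * m + a * l + b * k + dot t s); ring.
Qed.

(* The columns of [X / p] and of [Y / p] span isotropic lines, different from that of the standard
   lattice, in a hyperbolic plane over F_p, which has only two isotropic lines. *)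
Lemma two_isotropic_lines (X Y : 'M[int]_n) (N N' : int) :
  X^T *m X = (p%:Z * p%:Z * N)%:M -> Y^T *m Y = (p%:Z * p%:Z * N')%:M ->
  (forall j, orth_krylov (red (col j X))) -> (forall j, orth_krylov (red (col j Y))) ->
  red X != 0 -> red Y != 0 ->
  exists Z, X^T *m Y = (p%:Z * p%:Z) *: Z.
Proof.
move=> XX YY oX oY nzX nzY.
have nz_col (A : 'M[int]_n) : red A != 0 -> exists j, red (col j A) != 0.
  move=> nzA; apply/existsP; apply: contraNT nzA; rewrite negb_exists => /forallP A0.
  apply/eqP/matrixP=> i j; have := A0 j; rewrite negbK => /eqP/colP/(_ i).
  by rewrite !mxE.
have [k nz_k] := nz_col _ nzX; have [l nz_l] := nz_col _ nzY.
have dXX i j : (p%:Z * p%:Z %| dot (col i X) (col j X))%Z.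
  by rewrite -mul_trmx_dot XX mxE -mulrnAr dvdz_mulr.
have dYY i j : (p%:Z * p%:Z %| dot (col i Y) (col j Y))%Z.
  by rewrite -mul_trmx_dot YY mxE -mulrnAr dvdz_mulr.
(* One pair of columns that are nonzero modulo [p] starts the argument; divisibility then spreads to
   all columns of [Y], and from there to all columns of [X]. *)
have dkl : (p%:Z * p%:Z %| dot (col k X) (col l Y))%Z by exact: dot_line_sq.
have dkj j : (p%:Z * p%:Z %| dot (col k X) (col j Y))%Z.
  by apply: (@dot_line_transfer (col l Y)) => //; rewrite dotC.
have dij i j : (p%:Z * p%:Z %| dot (col i X) (col j Y))%Z.
  by apply: (@dot_line_transfer (col k X)).
exists (\matrix_(i, j) (dot (col i X) (col j Y) %/ (p%:Z * p%:Z))%Z).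
apply/matrixP=> i j; rewrite mul_trmx_dot [RHS]mxE [X in _ * X]mxE mulrC divzK //.
Qed.

(* If [z <> 0], then [z = f(S) e] with [f] of exact degree [d - 1], so the eigenvalue of [V] on
   [z] is [m (-1)^(d-1)]; but [p y = mu(S) e] with [mu] of degree [d] makes it [m (-1)^d]. *)
Lemma no_isotropic_fixed_line (V : 'M[int]_n) (m : int) (z : 'cV[F]_n) (t : F) :
  V^T = V -> V *m S = - (S *m V) -> V *m const_mx 1 = m *: (const_mx 1 : 'cV_n) ->
  V *m V = (m * m)%:M -> ~~ (p %| m)%Z ->
  orth_krylov z -> dot z z = 0 -> Sb *m z = t *: z -> z = 0.
Proof.
move=> VT VS Ve VV nm oz zz Sz; apply/eqP; apply: contraTT isT => nz_z /=.
have nz_m : m%:~R != 0 :> F by rewrite intr_Fp_eq0.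
have VSb : red V *m Sb = - (Sb *m red V) by rewrite -!map_mxM VS map_mxN.
have Veb : red V *m const_mx 1 = m%:~R *: (const_mx 1 : 'cV_n).
  have := congr1 red Ve; rewrite map_mxM map_mxZ /=.
  have -> // : red (const_mx 1) = const_mx 1 :> 'cV_n by apply/colP=> i; rewrite !mxE.
have kryV f : red V *m kry Sb f = m%:~R *: kry Sb (f \Po (- 'X)) by exact: anticomm_kry.
have oVz : orth_krylov (red V *m z).
  by move=> f; rewrite dotC dot_mull map_trmx VT kryV dotZr dotC oz mulr0.
have [l el] := orth_krylov_line oz oVz nz_z.
have nz_l : l != 0.
  apply: contraNneq nz_z => l0; have := congr1 (mulmx (red V)) el.
  rewrite mulmxA -map_mxM VV map_scalar_mx mul_scalar_mx l0 scale0r mulmx0 rmorphM => /eqP.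
  by rewrite scaler_eq0 mulf_eq0 (negbTE nz_m).
have eq_opp (c : F) : c = - c -> c = 0.
  by move=> ec; apply/eqP; rewrite -(mulrI_eq0 _ (mulfI two_neq0)) mulr_natl mulr2n {1}ec addNr.
(* As [V] anticommutes with [S], it sends the eigenvalue [t] to [- t]; but V z is a nonzero multiple
   of [z]. *)
have t0 : t = 0.
  have : (t * l) *: z = - (t * l) *: z.
    rewrite -{1}scalerA -el scalemxAr -Sz mulmxA VSb mulNmx -mulmxA el -scalemxAr Sz.
    by rewrite scalerA mulrC scaleNr.
  move/eqP; rewrite -subr_eq0 -scalerBl scaler_eq0 (negbTE nz_z) orbF subr_eq0 => /eqP/eq_opp/eqP.
  by rewrite mulf_eq0 (negbTE nz_l) orbF => /eqP.
have [f szf ef] := isotropic_orth_krylov oz zz.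
have nz_f : f != 0 by apply: contraNneq nz_z => f0; rewrite ef f0 kry0.
have d_gt0 : (0 < d)%N by rewrite (leq_trans _ szf) // size_poly_gt0.
pose mub := map_poly (intr : int -> F) mu.
have mub_top : mub`_d = 1.
  by rewrite coef_map /=; move/monicP: mon_mu; rewrite /lead_coef sz_mu /= => ->.
have sz_mub : (size mub <= d.+1)%N by rewrite -sz_mu size_poly.
have kry_mub : kry Sb mub = 0 by rewrite -map_kry mu_y map_intr_FpM.
have drop_top (g : {poly F}) : (size g <= d.+1)%N -> kry Sb g = 0 -> g = g`_d *: mub.
  move=> szg g0; apply/eqP; rewrite -subr_eq0; apply/eqP/min_d; last first.
    by rewrite kryB kryZ kry_mub g0 scaler0 subr0.
  apply/leq_sizeP=> j; rewrite leq_eqVlt coefB coefZ => /predU1P[<-|lt_dj].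
    by rewrite mub_top mulr1 subrr.
  rewrite (nth_default 0 (leq_trans szg lt_dj)) (nth_default 0 (leq_trans sz_mub lt_dj)).
  by rewrite mulr0 subr0.
(* S z = 0 says that X f annihilates e; having degree at most [d], it is a multiple of the minimal
   annihilator. So [f] has degree exactly [d - 1]. *)
have eXf : 'X * f = f`_d.-1 *: mub.
  rewrite [LHS]drop_top ?coefXM ?gtn_eqF //.
    by rewrite mulrC size_mulX // ltnS.
  by rewrite kryXM -ef Sz t0 scale0r.
have nz_top : f`_d.-1 != 0.
  apply: contraNneq nz_f => f0; move/eqP: eXf; rewrite f0 scale0r mulf_eq0.
  by rewrite polyX_eq0.
have lf : l *: f = m%:~R *: (f \Po (- 'X)).
  apply/eqP; rewrite -subr_eq0; apply/eqP/min_d.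
    rewrite (leq_trans (size_polyD _ _)) // size_polyN geq_max !(leq_trans (size_scale_leq _ _)) //.
    exact: leq_trans (size_comp_oppX f) szf.
  by rewrite kryB !kryZ -kryV -ef el subrr.
have el1 : l = m%:~R * (-1) ^+ d.-1.
  apply: (mulIf nz_top); rewrite -mulrA -coef_comp_oppX -!coefZ.
  by rewrite lf.
have kry_muN : mub \Po (- 'X) = (-1) ^+ d *: mub.
  rewrite [LHS]drop_top ?coef_comp_oppX ?mub_top ?mulr1 //.
    exact: leq_trans (size_comp_oppX _) sz_mub.
  by apply: (scalerI nz_m); rewrite -kryV kry_mub mulmx0 scaler0.
have [nu enu] : exists nu, (mu \Po (- 'X)) - (-1) ^+ d *: mu = p%:Z *: nu.
  exists (map_poly (fun c => (c %/ p)%Z) ((mu \Po (- 'X)) - (-1) ^+ d *: mu)).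
  apply/polyP=> i; rewrite coefZ coef_map_id0 ?div0z // mulrC divzK // -intr_Fp_eq0 //.
  have /polyP/(_ i) := kry_muN; rewrite !(coef_comp_oppX, coefZ, coefB) coef_map /= => eqi.
  by rewrite rmorphB /= !intrM !rmorphXn /= rmorphN1 eqi subrr.
have eVy : V *m y = (m * (-1) ^+ d) *: y + m *: kry S nu.
  apply: (scalemxI (p_neq0 p_pr)).
  rewrite scalemxAr -mu_y (anticomm_kry VS Ve) -[mu \Po _](subrK ((-1) ^+ d *: mu)) enu.
  by rewrite kryD !kryZ mu_y !scalerDr !scalerA addrC; congr (_ *: _ + _ *: _); ring.
have nz_yz : dot (red y) z != 0.
  by apply: contraNneq nz_z => /(orth_krylov_eq0 oz)->.
(* Pair V y with [z] and use the symmetry of [V]; the term in [nu] disappears because [z] is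
   orthogonal to the Krylov space. *)
have el2 : l = m%:~R * (-1) ^+ d.
  apply: (mulIf nz_yz); rewrite -dotZr -el -{1}VT -map_trmx -dot_mull -map_mxM eVy.
  rewrite map_mxD !map_mxZ dotDl !dotZl map_kry oz mulr0 addr0 rmorphM /=.
  by rewrite rmorphXn rmorphN1.
have /eqP : m%:~R * (-1) ^+ d.-1 = 0 :> F.
  apply: eq_opp; rewrite -el1 {1}el2 -{1}(prednK d_gt0) exprS mulN1r mulrN el1 //.
by rewrite mulf_eq0 (negbTE nz_m) signr_eq0.
Qed.
End Odd.

(** * From generalized cospectrality to an orthogonal matrix *)

(** Both sides come from the block matrix with rows (A, u) and (v, 1): clearing [v] by columns gives
    the left side, clearing it by rows gives [\det A] times the right side. *)
Lemma det_sub_rank1 (R : idomainType) n (A : 'M[R]_n) (u : 'cV_n) (v : 'rV_n) :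
  \det A != 0 -> \det (A - u *m v) = \det A - (v *m \adj A *m u) 0 0.
Proof.
move=> nzA; pose X := block_mx A u v (1%:M : 'M_1).
have -> : \det (A - u *m v) = \det X.
  have -> : \det X = \det (X *m block_mx 1%:M 0 (- v) 1%:M).
    by rewrite det_mulmx det_lblock !det1 !mulr1.
  rewrite mulmx_block !mulmx1 !mulmx0 !mul1mx !add0r mulmxN subrr.
  by rewrite det_ublock det1 mulr1.
apply: (mulfI nzA); transitivity (\det (block_mx 1%:M 0 (- (v *m \adj A)) (\det A)%:M *m X)).
  by rewrite det_mulmx det_lblock det1 mul1r det_scalar1.
rewrite mulmx_block !mul1mx !mul0mx !addr0 !mulmx1 mulNmx -mulmxA mul_adj_mx.
rewrite mul_mx_scalar mul_scalar_mx addNr.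
rewrite det_ublock; congr (_ * _); rewrite [X in \det X]mx11_scalar det_scalar1.
by rewrite mulNmx mxE addrC [X in X + _]mxE eqxx mulr1n [X in _ + X]mxE.
Qed.

Lemma size_det_leq (R : comNzRingType) m (A : 'M[{poly R}]_m) :
  (forall i j, (size (A i j) <= 2)%N) -> (size (\det A) <= m.+1)%N.
Proof.
move=> szA; rewrite (leq_trans (size_sum _ _ _)) //; apply/bigmax_leqP=> s _.
rewrite -signr_odd; suff szp : (size (\prod_i A i (s i))%R <= m.+1)%N.
  by case: odd; rewrite ?mulN1r ?mul1r ?size_polyN.
rewrite (leq_trans (size_poly_prod_leq _ _)) // card_ord leq_subLR addnS ltnS.
rewrite (leq_trans (leq_sum _ (fun i _ => szA i (s i)))) // sum_nat_const card_ord; lia.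
Qed.

Section WalkCounts.
Variable n' : nat.
Local Notation n := n'.+1.
Implicit Types S T : 'M[rat]_n.

(** The characteristic matrix of - I - S. Subtracting the rank-one matrix J gives that of J - I -
    S. *)
Let shift S : 'M[{poly rat}]_n := ('X + 1)%:M + map_mx polyC S.

Let walk_poly S k : {poly rat} :=
  ((const_mx 1 : 'rV_n) *m map_mx polyC (S ^+ k) *m \adj (shift S) *m (const_mx 1 : 'cV_n)) 0 0.

Let det_shift S : S^T = - S -> \det (shift S) = char_poly S \Po ('X + 1).
Proof.
move=> skew; rewrite -det_tr /char_poly /char_poly_mx -det_map_mx /=; congr (\det _).
apply/matrixP=> i j; have := congr1 (fun M : 'M_n => M i j) skew; rewrite !mxE => eS.
rewrite rmorphB rmorphMn /= comp_polyX comp_polyC eS polyCN eq_sym; congr (_ + _).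
Qed.

Let size_walk_poly S k : (size (walk_poly S k) <= n)%N.
Proof.
have szM m1 m2 m3 (A : 'M[{poly rat}]_(m1, m2)) (B : 'M[{poly rat}]_(m2, m3)) i j :
  (forall i j, (size (A i j) <= 1)%N) -> (forall i j, (size (B i j) <= n)%N) ->
  (size ((A *m B)%R i j) <= n)%N.
  move=> szA szB; rewrite mxE (leq_trans (size_sum _ _ _)) //; apply/bigmax_leqP=> l _.
  rewrite (size1_polyC (szA _ _)) mul_polyC.
  exact: leq_trans (size_scale_leq _ _) (szB _ _).
rewrite /walk_poly -mulmxA; apply: szM => i j.
  have -> : (const_mx 1 : 'rV_n) *m map_mx polyC (S ^+ k) = map_mx polyC (const_mx 1 *m S ^+ k).
    by rewrite map_mxM; congr (_ *m _); apply/matrixP=> a b; rewrite !mxE.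
  by rewrite mxE size_polyC leq_b1.
rewrite mxE (leq_trans (size_sum _ _ _)) //; apply/bigmax_leqP=> l _.
rewrite [const_mx _ _ _]mxE mulr1 mxE /cofactor -signr_odd.
suff szc : (size (\det (row' l (col' i (shift S)))) <= n)%N.
  by case: odd; rewrite ?mulN1r ?mul1r ?size_polyN.
apply: size_det_leq => a b; rewrite !mxE (leq_trans (size_polyD _ _)) // geq_max.
rewrite (leq_trans (size_polyC_leq1 _)) // andbT.
by case: (_ == _); rewrite ?mulr0n ?size_poly0 // mulr1n -[1](polyC1) size_XaddC.
Qed.

(** Insert [shift S] between S^k and its adjugate, whose product is the scalar [\det (shift S)]. *)
Let walk_poly_rec S k :
  ('X + 1) * walk_poly S k + walk_poly S k.+1 =
  (((const_mx 1 : 'rV_n) *m S ^+ k *m (const_mx 1 : 'cV_n)) 0 0)%:P * \det (shift S).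
Proof.
pose u : 'rV[{poly rat}]_n := const_mx 1; pose v : 'cV[{poly rat}]_n := const_mx 1.
have -> : walk_poly S k.+1
    = (u *m map_mx polyC (S ^+ k) *m map_mx polyC S *m \adj (shift S) *m v) 0 0.
  by rewrite /walk_poly exprSr map_mxM !mulmxA.
have -> : ('X + 1) * walk_poly S k
    = (u *m map_mx polyC (S ^+ k) *m ('X + 1)%:M *m \adj (shift S) *m v) 0 0.
  by rewrite mul_mx_scalar -!scalemxAl mxE.
have addE (A B : 'M[{poly rat}]_1) : A 0 0 + B 0 0 = (A + B) 0 0 by rewrite mxE.
rewrite addE -!mulmxDl -mulmxDr -/(shift S) -[_ *m _ *m \adj _]mulmxA mul_mx_adj.
rewrite mul_mx_scalar -scalemxAl mxE mulrC; congr (_ * _).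
transitivity (map_mx polyC ((const_mx 1 : 'rV_n) *m S ^+ k *m (const_mx 1 : 'cV_n)) 0 0).
  2: by rewrite mxE.
rewrite !map_mxM.
by congr ((_ *m _ *m _) 0 0); apply/matrixP=> i j; rewrite !mxE.
Qed.

(** The two spectra determine [\det (shift S)] and [walk_poly S 0]. In the recurrence the walk
    polynomials have degree below [n] while the determinant has degree [n], so equal [k]-th
    polynomials force equal counts, and then equal next polynomials. *)
Lemma eq_walk_counts S T : S^T = - S -> T^T = - T ->
  char_poly S = char_poly T ->
  char_poly (Jmx n - 1%:M - S) = char_poly (Jmx n - 1%:M - T) ->
  forall k, dot (const_mx 1) (kry S 'X^k) = dot (const_mx 1) (kry T 'X^k).
Proof.
move=> skS skT eqchar eqJ.
have eqdet : \det (shift S) = \det (shift T) by rewrite !det_shift ?eqchar.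
have sz_det U : U^T = - U -> size (\det (shift U)) = n.+1.
  by move=> skU; rewrite det_shift // size_comp_poly2 ?size_char_poly // -[1]polyC1 size_XaddC.
have walk0 U : U^T = - U -> walk_poly U 0 = \det (shift U) - char_poly (Jmx n - 1%:M - U).
  move=> skU; have nz : \det (shift U) != 0 by rewrite -size_poly_eq0 sz_det.
  have -> : char_poly (Jmx n - 1%:M - U)
      = \det (shift U - (const_mx 1 : 'cV_n) *m (const_mx 1 : 'rV_n)).
    rewrite /char_poly; congr (\det _); apply/matrixP=> i j; rewrite !mxE big_ord1 !mxE.
    rewrite !polyCB polyCMn mulrnDl; ring.
  rewrite det_sub_rank1 // opprB addrC subrK /walk_poly expr0.
  by rewrite map_mx1 mulmx1.
have eqP : forall k, walk_poly S k = walk_poly T k /\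
    dot (const_mx 1) (kry S 'X^k) = dot (const_mx 1) (kry T 'X^k).
  have step k : walk_poly S k = walk_poly T k ->
      dot (const_mx 1) (kry S 'X^k) = dot (const_mx 1) (kry T 'X^k) /\
      walk_poly S k.+1 = walk_poly T k.+1.
    move=> eqk; have es := walk_poly_rec S k; have et := walk_poly_rec T k.
    have e1 U : ((const_mx 1 : 'rV_n) *m U ^+ k *m (const_mx 1 : 'cV_n)) 0 0
        = dot (const_mx 1) (kry U 'X^k).
      by rewrite /dot kryXn mulmxA trmx_const.
    rewrite !e1 ?eqk ?eqdet in es et; move: es et; set s := dot _ _; set t := dot _ _ => es et.
    have ed : walk_poly S k.+1 - walk_poly T k.+1 = (s - t) *: \det (shift T).
      by rewrite -mul_polyC polyCB mulrBl -es -et; ring.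
    have st : s - t = 0.
      apply/eqP; apply: contraTT (leqnn n) => nz; rewrite -ltnNge.
      rewrite -[X in (X <= _)%N](sz_det T) // -(size_scale _ nz) -ed.
      by rewrite (leq_trans (size_polyD _ _)) // size_polyN geq_max !size_walk_poly.
    split; first exact: subr0_eq.
    by apply: subr0_eq; rewrite ed st scale0r.
  elim=> [|k [ek _]]; last by have [_ ek1] := step k ek; split=> //; case: (step _ ek1).
  have ek : walk_poly S 0 = walk_poly T 0 by rewrite !walk0 // eqJ eqdet.
  by split=> //; case: (step _ ek).
by move=> k; case: (eqP k).
Qed.

End WalkCounts.

(** * The orthogonal matrix carrying one walk matrix to the other *)

Lemma eq_cols (R : Type) m k (A B : 'M[R]_(m, k)) : (forall j, col j A = col j B) -> A = B.
Proof.
move=> eAB; apply/matrixP=> i j; have := congr1 (fun M : 'cV_m => M i 0) (eAB j).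
by rewrite !mxE.
Qed.

Lemma mulmx_kry_inj (K : fieldType) n' (T : 'M[K]_n'.+1) (A B : 'M[K]_n'.+1) :
  \det (krylov T n'.+1) != 0 ->
  (forall k, A *m kry T 'X^k = B *m kry T 'X^k) -> A = B.
Proof.
move=> nzT eAB; have uT : krylov T n'.+1 \in unitmx by rewrite unitmxE unitfE.
rewrite -[A](mulmxK uT) -[B](mulmxK uT); congr (_ *m _).
by apply: eq_cols => j; rewrite !colE -!mulmxA -!colE col_krylov.
Qed.

(** Equal walk counts give equal Gram matrices of the walk matrices, so [WS *m invmx WT] is
    orthogonal. It sends T^k e to S^k e for every [k], not only [k < n], whence regularity ([k = 0])
    and the intertwining relation. *)
Lemma exists_intertwiner n' (S T : 'M[rat]_n'.+1) : S^T = - S -> T^T = - T ->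
  char_poly S = char_poly T ->
  char_poly (Jmx n'.+1 - 1%:M - S) = char_poly (Jmx n'.+1 - 1%:M - T) ->
  \det (krylov S n'.+1) != 0 ->
  exists Q, reg_rat_orth Q /\ S *m Q = Q *m T.
Proof.
set n := n'.+1 => skS skT eqc eqJ nzS; have eqw := eq_walk_counts skS skT eqc eqJ.
pose WS := krylov S n; pose WT := krylov T n.
have eq_gram k : WS^T *m kry S 'X^k = WT^T *m kry T 'X^k.
  by apply/colP=> i; rewrite !mul_trmx_dotl !col_krylov !dot_kryXn // -exprD eqw.
have eq_gram2 : WS^T *m WS = WT^T *m WT.
  by apply: eq_cols => j; rewrite !colE -!mulmxA -!colE !col_krylov.
have uS : WS \in unitmx by rewrite unitmxE unitfE.
have uT : WT \in unitmx.
  rewrite unitmxE unitfE; apply: contraNneq nzS => T0.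
  have := congr1 determinant eq_gram2; rewrite !det_mulmx T0 mulr0 det_tr => /eqP.
  by rewrite mulf_eq0 orbb.
have nzT : \det WT != 0 by rewrite -unitfE -unitmxE.
pose Q := WS *m invmx WT.
have Qkry k : Q *m kry T 'X^k = kry S 'X^k.
  have uSt : WS^T \in unitmx by rewrite unitmx_tr.
  apply: (can_inj (mulKmx uSt)).
  by rewrite eq_gram /Q !mulmxA eq_gram2 mulmxK.
exists Q; split; last first.
  apply: (mulmx_kry_inj nzT) => k.
  by rewrite -mulmxA Qkry -mulmxA -!kryXM -exprS Qkry.
split; last by have := Qkry 0%N; rewrite expr0 !kry1.
apply: mulmx1C; rewrite /Q trmx_mul mulmxA -(mulmxA _ WS^T) eq_gram2 mulmxA -trmx_mul.
by rewrite mulmxV // trmx1 mul1mx mulmxV.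
Qed.

(** * Integrality of intertwiners at a prime *)

Lemma intertwine_horner (R : comNzRingType) n' (A S T : 'M[R]_n'.+1) f :
  A *m S = T *m A -> A *m horner_mx S f = horner_mx T f *m A.
Proof.
move=> AS; elim/poly_ind: f => [|f c IHf]; first by rewrite !rmorph0 mulmx0 mul0mx.
rewrite !rmorphD !rmorphM /= !horner_mx_C !horner_mx_X.
rewrite mulmxDr mulmxDl [_ * S]/(mulmx _ S) mulmxA IHf -mulmxA AS scalar_mxC.
by rewrite [_ * T]/(mulmx _ T) mulmxA.
Qed.

Local Notation ratmx := (map_mx (intr : int -> rat)).

Lemma ratmx_inj m k : injective (map_mx intr : 'M[int]_(m, k) -> 'M[rat]_(m, k)).
Proof.
move=> A B eAB; apply/matrixP=> i j; have := congr1 (fun M : 'M_(m, k) => M i j) eAB.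
by rewrite !mxE => /intr_inj.
Qed.

Lemma ratmxZ m k c (A : 'M[int]_(m, k)) : ratmx (c *: A) = c%:~R *: ratmx A.
Proof. by rewrite map_mxZ. Qed.

Lemma map_const1 (R : nzRingType) n :
  map_mx intr (const_mx 1 : 'cV[int]_n) = (const_mx 1 : 'cV[R]_n).
Proof. by apply/matrixP=> i j; rewrite !mxE. Qed.

Section Intertwiner.
Variable n' : nat.
Local Notation n := n'.+1.
Implicit Types (S T X : 'M[int]_n) (Q : 'M[rat]_n).

Definition intertwiner S T Q := reg_rat_orth Q /\ ratmx S *m Q = Q *m ratmx T.

(** For orthogonal [Q] this says that [Q] preserves the lattice Z_p^n; a common denominator prime to
    [p] avoids p-adic numbers. *)
Definition p_integral (p : nat) Q :=
  exists (m : int) X, ~~ (p %| m)%Z /\ m%:~R *: Q = ratmx X.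

Lemma intertwiner_tr S T Q : intertwiner S T Q ->
  Q^T *m ratmx S = ratmx T *m Q^T /\ Q^T *m ones n = ones n.
Proof.
move=> [[QQ Qe] SQ]; have QtQ := mulmx1C QQ; split.
  by rewrite -[LHS]mulmx1 -QQ !mulmxA -(mulmxA _ _ Q) SQ mulmxA QtQ mul1mx.
by rewrite -{1}Qe mulmxA QtQ mul1mx.
Qed.

Lemma intertwiner_kry S T Q f : intertwiner S T Q ->
  Q^T *m kry (ratmx S) f = kry (ratmx T) f.
Proof.
move=> iQ; have [QS Qe] := intertwiner_tr iQ.
by rewrite /kry mulmxA (intertwine_horner f QS) -mulmxA Qe.
Qed.

Section Scaled.
Variables (S T X : 'M[int]_n) (Q : 'M[rat]_n) (m : int).
Hypotheses (iQ : intertwiner S T Q) (mX : m%:~R *: Q = ratmx X).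

Lemma scaled_gram : X^T *m X = (m * m)%:M.
Proof.
have [[/mulmx1C QQ _] _] := iQ; apply: ratmx_inj.
rewrite map_mxM -map_trmx -mX [(_ *: Q)^T]linearZ /= -scalemxAl -scalemxAr QQ scalerA.
by rewrite map_scalar_mx /= intrM scalemx1.
Qed.

Lemma scaled_intertwine : S *m X = X *m T.
Proof.
have [_ SQ] := iQ; apply: ratmx_inj.
by rewrite !map_mxM -mX -scalemxAr SQ scalemxAl.
Qed.

Lemma scaled_one : X *m const_mx 1 = m *: (const_mx 1 : 'cV_n).
Proof.
have [[_ Qe] _] := iQ; apply: ratmx_inj.
by rewrite map_mxM ratmxZ map_const1 -mX -scalemxAl Qe.
Qed.

Lemma scaled_kry f : X^T *m kry S f = m *: kry T f.
Proof.
apply: ratmx_inj; rewrite map_mxM ratmxZ -map_trmx -mX [(_ *: Q)^T]linearZ /= -scalemxAl !map_kry.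
by rewrite (intertwiner_kry _ iQ).
Qed.
End Scaled.

(** [Q^T] carries the walk matrix of [S] to that of [T], so a quasi-inverse of the former exhibits
    [c] as a denominator of [Q]. *)
Lemma quasi_inverse_integral S T Q C c : intertwiner S T Q ->
  krylov S n *m C = c%:M -> c%:~R *: Q = ratmx (krylov T n *m C)^T.
Proof.
move=> iQ eC; rewrite -map_trmx map_mxM map_krylov.
have <- : Q^T *m krylov (ratmx S) n = krylov (ratmx T) n.
  by apply: eq_cols => j; rewrite !colE -mulmxA -!colE !col_krylov (intertwiner_kry _ iQ).
rewrite -map_krylov -mulmxA -map_mxM eC map_scalar_mx mul_mx_scalar.
by rewrite linearZ /= trmxK.
Qed.

Lemma p_integral_mul p Q X m k : prime p -> ~~ (p %| k)%Z ->
  (p%:Z ^+ m * k)%:~R *: Q = ratmx (p%:Z ^+ m *: X) -> p_integral p Q.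
Proof.
move=> p_pr pk; rewrite ratmxZ intrM -scalerA => eX; exists k, X; split=> //.
by apply: scalerI eX; rewrite intr_eq0 expf_neq0 // p_neq0.
Qed.

(** * Denominators of intertwiners at 2 and at odd primes *)

Section Level.
Variables (S : 'M[int]_n) (z : int).
Hypothesis skew : S^T = - S.
Hypothesis det_walk : \det (krylov S n) = 2 ^+ n./2 * z.
Hypothesis odd_z : ~~ (2 %| z)%Z.
Hypothesis sqf_z : forall p, prime p -> ~~ (p%:Z * p%:Z %| z)%Z.

(** Twice an odd number is a denominator, giving an integral multiple [X] of [Q]. As X^T S^k X = X^T
    X T^k is divisible by 4 and X^T S^k e by 2, the columns of [X] satisfy [krylov_isotropic_mod2]
    and the factor 2 cancels. *)
Lemma intertwiner_integral_at2 T Q : intertwiner S T Q -> p_integral 2 Q.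
Proof.
move=> iQ; have p2 : prime 2 by [].
have [d [mu [y [mon sz le_dn mu_y min_d]]]] := min_annihilator p2 S.
have odd_b := odd_det_kry_basis skew det_walk odd_z mon sz le_dn mu_y min_d.
have [C eC] := krylov_quasi_inverse mon sz mu_y.
have := quasi_inverse_integral iQ eC; set X := (_ *m C)^T => eX.
have [X' eX'] : exists X', X = 2%:Z *: X'.
  apply: (map_intr_Fp_eq0 p2); apply: eq_cols => j; rewrite -map_col.
  rewrite (krylov_isotropic_mod2 skew det_walk odd_z mon sz le_dn mu_y min_d).
  - by apply/colP=> i; rewrite !mxE.
  - move=> k; have -> : S ^+ k *m col j X = col j (S ^+ k *m X) by rewrite !colE mulmxA.
    rewrite -mul_trmx_dot.
    have -> : S ^+ k *m X = X *m T ^+ k.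
      rewrite -!horner_mxXn; apply/esym/intertwine_horner/esym.
      exact: scaled_intertwine iQ eX.
    rewrite mulmxA (scaled_gram iQ eX) mul_scalar_mx mxE.
    by rewrite mulrACA dvdz_mulr // dvdz_mulr.
  move=> k; rewrite dotC -mul_trmx_dotl (scaled_kry iQ eX) mxE.
  by rewrite -mulrA dvdz_mulr.
by apply: (p_integral_mul (X := X') (m := 1) p2 odd_b); rewrite expr1 -eX'.
Qed.

Section OddPrime.
Variable p : nat.
Hypotheses (p_pr : prime p) (p_odd : odd p).
Local Notation F := 'F_p.
Local Notation red := (map_mx (intr : int -> F)).

Lemma dvd_det_walk_integral T Q : intertwiner S T Q ->
  ~~ (p %| \det (krylov S n))%Z -> p_integral p Q.
Proof.
move=> iQ pd; have := quasi_inverse_integral iQ (mul_mx_adj (krylov S n)).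
by set X := (_ *m _)^T; exists (\det (krylov S n)), X.
Qed.

(** The determinant is p^(n-d) times that of the basis, and p^2 does not divide it. Since [p] does,
    [n - d] is 1 and the other factor is prime to [p]. *)
Lemma kry_basis_odd_prime : (p %| \det (krylov S n))%Z ->
  exists (d : nat) (mu : {poly int}) (y : 'cV[int]_n),
  [/\ mu \is monic /\ size mu = d.+1, d = n', kry S mu = p%:Z *: y,
      (forall f : {poly F}, (size f <= d)%N -> kry (red S) f = 0 -> f = 0) &
      ~~ (p %| \det (kry_basis S d y))%Z].
Proof.
move=> pW; have [d [mu [y [mon sz le_dn mu_y min_d]]]] := min_annihilator p_pr S.
have det_W := det_krylov le_dn mon sz mu_y.
have p_2 : ~~ (p %| 2)%Z.
  by rewrite dvdzE /= dvdn_prime2 //; case: eqP p_odd => // ->.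
have sqW : ~~ (p%:Z * p%:Z %| \det (krylov S n))%Z.
  apply: contra (sqf_z p_pr); rewrite det_walk Gauss_dvdzr //.
  rewrite coprimezE abszM abszX coprimeMl andbb coprimeXr //.
  by rewrite prime_coprime.
have lt_dn : (d < n)%N.
  rewrite ltn_neqAle le_dn andbT; apply: contraTneq pW => dn.
  rewrite -intr_Fp_eq0 // -det_map_mx map_krylov -unitfE -unitmxE.
  rewrite -row_full_unit /row_full; apply/eqP.
  by have := rank_krylov min_d; rewrite dn.
have nd1 : d = n'.
  apply/eqP; rewrite eqn_leq -ltnS lt_dn leqNgt; apply: contra sqW => lt_dn'.
  rewrite det_W; have -> : (n - d = (n - d - 2) + 2)%N by rewrite subnK // ltn_subRL addn1 ltnS.
  by rewrite exprD expr2; apply/dvdz_mull/dvdz_mull.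
exists d, mu, y; split=> //; apply: contra sqW => pB; rewrite det_W.
have -> : (n - d = 1)%N by rewrite nd1 subSnn.
by rewrite expr1 dvdz_mul.
Qed.

Lemma orth_krylov_scaled T Q X m (w : 'cV[F]_n) : intertwiner S T Q ->
  m%:~R *: Q = ratmx X -> (p %| m)%Z -> orth_krylov S (red X *m w).
Proof.
move=> iQ eX pm f; rewrite dotC dot_mull map_trmx -(lift_FpK f) -map_kry -map_mxM.
rewrite (scaled_kry iQ eX); case/dvdzP: pm => k ->.
by rewrite mulrC -scalerA map_intr_FpM // dot0r.
Qed.

Lemma p_scaled T Q : intertwiner S T Q -> exists (b : int) X,
  ~~ (p %| b)%Z /\ (p%:Z * b)%:~R *: Q = ratmx X.
Proof.
move=> iQ; have [pW|pW] := boolP (p %| \det (krylov S n))%Z.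
  have [d [mu [y [[mon sz] dn mu_y min_d unit_b]]]] := kry_basis_odd_prime pW.
  have [C eC] := krylov_quasi_inverse mon sz mu_y.
  by have := quasi_inverse_integral iQ eC; set X := _^T; exists (\det (kry_basis S d y)), X.
have [m [X [pm eX]]] := dvd_det_walk_integral iQ pW.
by exists m, (p%:Z *: X); rewrite ratmxZ -eX scalerA -intrM.
Qed.

Lemma p_scaled_neq0 Q b X : ~ p_integral p Q -> ~~ (p %| b)%Z ->
  (p%:Z * b)%:~R *: Q = ratmx X -> red X != 0.
Proof.
move=> npQ pb eX; apply/negP=> /eqP /(map_intr_Fp_eq0 p_pr)[X' eX']; apply: npQ.
by apply: (p_integral_mul (X := X') (m := 1) p_pr pb); rewrite expr1 -eX'.
Qed.

(** The multiples [X] of [Q] and [Y] of [R] are nonzero modulo [p] with columns in the orthogonal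
    line, so [two_isotropic_lines] makes X^T Y divisible by p^2, which cancels the two factors [p]
    in the denominators. *)
Lemma transfer_integral T U Q R : intertwiner S T Q -> intertwiner S U R ->
  ~ p_integral p Q -> ~ p_integral p R -> p_integral p (Q^T *m R).
Proof.
move=> iQ iR npQ npR.
have [pW|/(dvd_det_walk_integral iQ)//] := boolP (p %| \det (krylov S n))%Z.
have [d [mu [y [[mon sz] dn mu_y min_d unit_b]]]] := kry_basis_odd_prime pW.
have [a [X [pa eX]]] := p_scaled iQ; have [b [Y [pb eY]]] := p_scaled iR.
have orthc (Z : 'M[int]_n) : (forall w, orth_krylov S (red Z *m w)) ->
    forall j, orth_krylov S (red (col j Z)).
  by move=> oZ j; rewrite map_col colE.
have gram c : (p%:Z * c * (p%:Z * c))%:M = (p%:Z * p%:Z * (c * c))%:M :> 'M[int]_n.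
  by congr (_%:M); ring.
have [||||||Z eZ] := @two_isotropic_lines p n' S p_pr p_odd d y dn unit_b X Y (a * a) (b * b).
- by rewrite (scaled_gram iQ eX) gram.
- by rewrite (scaled_gram iR eY) gram.
- by apply: orthc => w; apply: (orth_krylov_scaled _ iQ eX); rewrite dvdz_mulr.
- by apply: orthc => w; apply: (orth_krylov_scaled _ iR eY); rewrite dvdz_mulr.
- exact: p_scaled_neq0 pa eX.
- exact: p_scaled_neq0 pb eY.
apply: (p_integral_mul (X := Z) (m := 2) (k := a * b) p_pr).
  by rewrite Euclid_dvdzM // negb_or pa.
rewrite expr2 -eZ map_mxM -map_trmx -eX -eY [(_ *: Q)^T]linearZ /= -scalemxAl -scalemxAr scalerA.
by rewrite -intrM; congr (_%:~R *: _); ring.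
Qed.

(** A nonzero column of [X] modulo [p] would span an isotropic line stable under [S]; an integral
    multiple of [Q0] by a factor prime to [p] then plays the role of [V] in
    [no_isotropic_fixed_line]. *)
Lemma reversal_integral T Q Q0 : intertwiner S T Q -> intertwiner S (- S) Q0 -> Q0^T = Q0 ->
  p_integral p Q0 -> p_integral p Q.
Proof.
move=> iQ iQ0 symQ0 [m [V [pm eV]]].
have [pW|/(dvd_det_walk_integral iQ)//] := boolP (p %| \det (krylov S n))%Z.
have [d [mu [y [[mon sz] dn mu_y min_d unit_b]]]] := kry_basis_odd_prime pW.
have [b [X [pb eX]]] := p_scaled iQ.
have [X0|nzX] := eqVneq (red X) 0.
  have [X' eX'] := map_intr_Fp_eq0 p_pr X0.
  by apply: (p_integral_mul (X := X') (m := 1) p_pr pb); rewrite expr1 -eX'.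
have oX w : orth_krylov S (red X *m w).
  by apply: (orth_krylov_scaled _ iQ eX); rewrite dvdz_mulr.
case/eqP: nzX; apply: eq_cols => k; rewrite col0 colE; set v := _ *m _.
have [//|nz_v] := eqVneq v 0.
have VT : V^T = V by apply: ratmx_inj; rewrite -map_trmx -eV linearZ /= symQ0.
have VS : V *m S = - (S *m V) by rewrite (scaled_intertwine iQ0 eV) mulmxN opprK.
have [t et] : exists t, red S *m v = t *: v.
  apply: (orth_krylov_line p_pr dn unit_b) => //; first exact: oX.
  by rewrite /v mulmxA -map_mxM (scaled_intertwine iQ eX) map_mxM -mulmxA; apply: oX.
apply: (no_isotropic_fixed_line p_pr p_odd mon sz dn mu_y min_d unit_b VT VS _ _ pm _ _ et).
- exact: scaled_one iQ0 eV.
- by rewrite -{1}VT (scaled_gram iQ0 eV).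
- exact: oX.
rewrite dot_mull mulmxA map_trmx -map_mxM (scaled_gram iQ eX) map_scalar_mx /=.
have -> : (p%:Z * b * (p%:Z * b))%:~R = 0 :> F.
  by apply/eqP; rewrite intr_Fp_eq0 // -mulrA dvdz_mulr.
by rewrite raddf0 mul0mx dot0r.
Qed.

End OddPrime.
End Level.
End Intertwiner.

(** * Levels *)

Lemma int_mxP n (A : 'M[rat]_n) : int_mx A <-> exists X, A = ratmx X.
Proof.
split=> [intA|[X ->] i j]; last by rewrite mxE; apply/intrP; exists (X i j).
by exists (map_mx numq A); apply/matrixP=> i j; rewrite !mxE numqK.
Qed.

Section Level.
Variable n : nat.
Implicit Types (Q : 'M[rat]_n) (l k : nat).

Lemma exists_level Q : exists l, is_level Q l.
Proof.
pose P k := (0 < k)%N && [forall i, forall j, (k%:R *: Q) i j \is a Num.int].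
have PP k : reflect ((0 < k)%N /\ int_mx (k%:R *: Q)) (P k).
  apply: (iffP andP) => [[k0 /forallP kQ]|[k0 kQ]]; split=> //.
    by move=> i j; have /forallP := kQ i.
  by apply/forallP=> i; apply/forallP=> j.
have exP : exists k, P k.
  (* The product of all denominators of the entries clears them all. *)
  exists (\prod_i \prod_j `|denq (Q i j)|%N)%N; apply/PP; split.
    by rewrite prodn_gt0 // => i; rewrite prodn_gt0 // => j; rewrite absz_gt0.
  move=> i j; rewrite mxE; set k := (\prod_(_ < _) _)%N.
  have /dvdnP[q ->] : (`|denq (Q i j)| %| k)%N.
    by rewrite /k (bigD1 i) //= dvdn_mulr // (bigD1 j) //= dvdn_mulr.
  rewrite natrM -mulrA rpredM ?natr_int // natr_absz gtr0_norm ?denq_gt0 //.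
  by rewrite mulrC -numqE intr_int.
case: (ex_minnP exP) => l /PP[l0 lQ] min_l; exists l; split=> //; split=> // k k0 kQ.
by apply: min_l; apply/PP.
Qed.

Lemma level_dvd Q l k : is_level Q l -> int_mx (k%:R *: Q) -> (l %| k)%N.
Proof.
move=> [l0 [lQ min_l]] kQ; rewrite /dvdn; apply: contraTT (ltn_pmod k l0).
rewrite -lt0n -leqNgt => r0; apply: min_l => // i j.
have -> : (k %% l)%:R = k%:R - (k %/ l)%:R * l%:R :> rat.
  by rewrite {2}(divn_eq k l) natrD natrM addrC addKr.
have -> : ((k%:R - (k %/ l)%:R * l%:R) *: Q) i j =
    (k%:R *: Q) i j - (k %/ l)%:R * (l%:R *: Q) i j.
  by rewrite !mxE mulrBl mulrA.
by rewrite rpredB ?kQ // rpredM ?natr_int ?lQ.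
Qed.

Lemma level_tr Q l : is_level Q l -> is_level Q^T l.
Proof.
have tr k A : int_mx (k%:R *: A) -> int_mx (k%:R *: A^T).
  by move=> kA i j; have := kA j i; rewrite !mxE.
move=> [l0 [lQ min_l]]; split=> //; split=> [|k k0 /tr]; first exact: tr.
by rewrite trmxK; apply: min_l.
Qed.

(** In an integral row the entries and their squares both sum to 1, so the nonnegative terms x^2 - x
    all vanish and the entries are 0 or 1. Orthogonality puts the ones of distinct rows in distinct
    columns. *)
Lemma level1_perm Q : reg_rat_orth Q -> is_level Q 1 -> is_perm_mx Q.
Proof.
move=> [QQ Qe] [_ [/int_mxP[X eX] _]]; rewrite scale1r in eX.
have XX : X *m X^T = 1%:M.
  by apply: ratmx_inj; rewrite map_mxM -map_trmx -eX QQ map_mx1.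
have Xe : X *m const_mx 1 = const_mx 1 :> 'cV_n.
  by apply: ratmx_inj; rewrite map_mxM !map_const1 -eX.
have sum_row i : \sum_j X i j = 1.
  have := congr1 (fun M : 'cV_n => M i 0) Xe; rewrite !mxE => <-.
  by apply: eq_bigr => j _; rewrite mxE mulr1.
have dot_rows (i k : 'I_n) : \sum_j X i j * X k j = (i == k)%:R.
  have := congr1 (fun M : 'M_n => M i k) XX; rewrite !mxE => <-.
  by apply: eq_bigr => j _; rewrite mxE.
have X01 i j : X i j = 0 \/ X i j = 1.
  have ge0 (x : int) : 0 <= x * x - x by nia.
  have : \sum_j (X i j * X i j - X i j) = 0 by rewrite sumrB dot_rows sum_row eqxx subrr.
  move/psumr_eq0P => /(_ (fun j _ => ge0 (X i j)) j isT).
  by set x := X i j; clearbody x; nia.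
have X_ge0 i j : 0 <= X i j by case: (X01 i j) => ->.
have ex1 i : exists j, X i j == 1.
  apply/existsP; rewrite -[[exists _, _]]negbK negb_exists; apply/negP=> /forallP X0.
  have := sum_row i; rewrite big1 // => j _; case: (X01 i j) => // X1.
  by have := X0 j; rewrite X1.
pose f i := xchoose (ex1 i).
have f1 i : X i (f i) = 1 by apply/eqP; exact: (xchooseP (ex1 i)).
have f_inj : injective f.
  move=> i k eik; apply/eqP; have := dot_rows i k.
  rewrite (bigD1 (f i)) //= f1 eik f1; case: eqP => // _.
  set s := \sum_(_ | _) _; have : 0 <= s by apply: sumr_ge0 => j _; rewrite mulr_ge0.
  by move=> s0 /eqP; rewrite mulr1 gt_eqF // ltr_pwDl.
apply/is_perm_mxP; exists (perm f_inj); apply/matrixP=> i j; rewrite eX !mxE permE.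
have [<-|ne_j] := eqVneq (f i) j; first by rewrite f1.
have := sum_row i; rewrite (bigD1 (f i)) //= f1 => /(canRL (addKr _)); rewrite addNr.
move/psumr_eq0P => /(_ (fun j _ => X_ge0 i j)) /(_ j) -> //.
by rewrite eq_sym.
Qed.

End Level.

Section PIntegral.
Variable n' : nat.
Implicit Types (Q : 'M[rat]_n'.+1).

Lemma level_dvdz Q l (m : int) X : is_level Q l -> m%:~R *: Q = ratmx X -> (l %| `|m|)%N.
Proof.
move=> lQ eX; apply: level_dvd lQ _; apply/int_mxP.
by exists (Num.sg m *: X); rewrite ratmxZ -eX scalerA -intrM -normrEsg natr_absz.
Qed.

Lemma p_integralP p Q l : is_level Q l -> p_integral p Q <-> ~~ (p %| l)%N.
Proof.
move=> lQ; split=> [[m [X [pm eX]]]|pl].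
  by apply: contra pm => pl; rewrite dvdzE /= (dvdn_trans pl) // (level_dvdz lQ eX).
have [l0 [/int_mxP[X eX] _]] := lQ.
by exists l%:Z, X.
Qed.

Lemma level_logn p Q l (b : int) X : prime p -> is_level Q l -> ~~ (p %| b)%Z ->
  (p%:Z * b)%:~R *: Q = ratmx X -> (logn p l <= 1)%N.
Proof.
move=> p_pr lQ pb /(level_dvdz lQ); rewrite abszM -[`|p%:Z|%N]/p => l_pb.
have b0 : (0 < `|b|)%N by rewrite absz_gt0; apply: contraNneq pb => ->.
have := dvdn_leq_log p _ l_pb; rewrite muln_gt0 prime_gt0 // b0 => /(_ isT) /leq_trans; apply.
by rewrite (lognM _ (prime_gt0 p_pr) b0) (logn_prime _ p_pr) eqxx logn_coprime // prime_coprime.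
Qed.

End PIntegral.

Lemma dvdn_squarefree l k : (0 < l)%N -> (0 < k)%N ->
  (forall p, prime p -> (logn p l <= 1)%N) ->
  (forall p, prime p -> (p %| l)%N -> (p %| k)%N) -> (l %| k)%N.
Proof.
move=> l0 k0 sqf sub; apply/dvdn_partP => // p; rewrite mem_primes => /and3P[p_pr _ pl].
by rewrite p_part (dvdn_trans (dvdn_exp2l _ (sqf p p_pr))) ?expn1 ?sub.
Qed.

(** * Oriented graphs and their integral skew-adjacency matrices *)

Definition int_skew n (arc : rel 'I_n) : 'M[int]_n :=
  \matrix_(i, j) (if arc i j then 1 else if arc j i then -1 else 0).

Lemma ratmx_int_skew n (arc : rel 'I_n) : ratmx (int_skew arc) = skew_adj arc.
Proof. by apply/matrixP=> i j; rewrite !mxE; case: ifP => // _; case: ifP. Qed.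

Lemma int_skew_tr n (arc : rel 'I_n) : oriented arc -> (int_skew arc)^T = - int_skew arc.
Proof.
move=> [_ asym]; apply/matrixP=> i j; rewrite !mxE.
have := asym i j; case: (arc i j) => [/(_ isT)/negbTE-> //|_].
by case: (arc j i); rewrite ?opprK ?oppr0.
Qed.

Lemma skew_adj_converse n (arc : rel 'I_n) : oriented arc ->
  skew_adj (converse arc) = - skew_adj arc.
Proof.
move=> [_ asym]; apply/matrixP=> i j; rewrite !mxE /converse.
have := asym i j; case: (arc i j) => [/(_ isT)/negbTE-> //|_].
by case: (arc j i); rewrite ?opprK ?oppr0.
Qed.

Lemma skew_adj_tr n (arc : rel 'I_n) : oriented arc -> (skew_adj arc)^T = - skew_adj arc.
Proof.
by move=> o; rewrite -ratmx_int_skew map_trmx int_skew_tr // map_mxN.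
Qed.

Lemma squarefree_dvdz (z : int) p : odd `|z|%N -> squarefree `|z|%N -> prime p ->
  ~~ (p%:Z * p%:Z %| z)%Z.
Proof.
move=> odd_z /forallP sqf p_pr; rewrite dvdzE abszM /=.
apply/negP=> pz; have z0 : (0 < `|z|)%N by case: `|z|%N odd_z.
(* [squarefree] tests only primes up to the number itself, which suffices as the number is
   positive. *)
have lt_p : (p < `|z|.+1)%N.
  by rewrite ltnS (leq_trans _ (dvdn_leq z0 pz)) // leq_pmulr // prime_gt0.
by have := sqf (Ordinal lt_p); rewrite p_pr pz.
Qed.

Lemma is_perm_isomorphic n (a b : rel 'I_n) (Q : 'M[rat]_n) : reg_rat_orth Q ->
  skew_adj a *m Q = Q *m skew_adj b -> is_perm_mx Q -> isomorphic b a.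
Proof.
move=> [QQ _] aQ /is_perm_mxP[s eQ]; exists (s^-1)%g.
by rewrite -tr_perm_mx trmxK -eQ -aQ -mulmxA QQ mulmx1.
Qed.

Lemma reg_rat_orthM n (Q R : 'M[rat]_n) : reg_rat_orth Q -> reg_rat_orth R -> reg_rat_orth (Q *m R).
Proof.
move=> [QQ Qe] [RR Re]; split; last by rewrite -mulmxA Re.
by rewrite trmx_mul mulmxA -(mulmxA Q) RR mulmx1.
Qed.

Lemma reg_rat_orth_tr n (Q : 'M[rat]_n) : reg_rat_orth Q -> reg_rat_orth Q^T.
Proof.
move=> [QQ Qe]; have QtQ := mulmx1C QQ; split; first by rewrite trmxK.
by rewrite -{1}Qe mulmxA QtQ mul1mx.
Qed.

(** * Comparing the levels and factoring [Q0] *)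

Section Main.
Variables (n' : nat) (S : 'M[int]_n'.+1) (z : int).
Local Notation n := n'.+1.
Hypothesis skew : S^T = - S.
Hypothesis det_walk : \det (krylov S n) = 2 ^+ n./2 * z.
Hypothesis odd_z : ~~ (2 %| z)%Z.
Hypothesis sqf_z : forall p, prime p -> ~~ (p%:Z * p%:Z %| z)%Z.

(** [Q0] and its transpose both anticommute with [S] and fix e, so they agree on every S^k e, and
    these vectors span. *)
Lemma skew_reversal_sym Q0 : intertwiner S (- S) Q0 -> Q0^T = Q0.
Proof.
move=> iQ0; have [Q0S Q0e] := intertwiner_tr iQ0; have [[_ Qe] SQ] := iQ0.
have nzW : \det (krylov (ratmx S) n) != 0.
  rewrite -map_krylov det_map_mx intr_eq0 det_walk mulf_neq0 ?expf_neq0 //.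
  by apply: contraNneq odd_z => ->; rewrite dvdz0.
apply: (mulmx_kry_inj nzW) => k.
rewrite (@anticomm_kry _ _ _ _ 1); first last.
- by rewrite scale1r Q0e.
- by rewrite Q0S map_mxN mulNmx.
rewrite (@anticomm_kry _ _ _ _ 1) //; last by rewrite scale1r Qe.
by rewrite SQ map_mxN mulmxN opprK.
Qed.

Variables (T : 'M[int]_n) (Q Q0 : 'M[rat]_n).
Hypotheses (iQ : intertwiner S T Q) (iQ0 : intertwiner S (- S) Q0).
Hypothesis iQ0Q : intertwiner S (- T) (Q0 *m Q).

Lemma level_intertwiner_sqf U R l p : intertwiner S U R -> is_level R l ->
  prime p -> (logn p l <= 1)%N /\ (p = 2%N -> ~~ (p %| l)%N).
Proof.
move=> iR lR p_pr; have [->|ne_p2] := eqVneq p 2%N.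
  have nd2 : ~~ (2 %| l)%N.
    by apply/(p_integralP 2 lR)/(intertwiner_integral_at2 skew det_walk odd_z iR).
  by split=> //; rewrite lognE (negbTE nd2) !andbF.
split=> [|p2]; last by rewrite p2 in ne_p2.
have p_odd : odd p by case: (even_prime p_pr) ne_p2 => // ->.
have [b [X [pb eX]]] := p_scaled det_walk sqf_z p_pr p_odd iR.
exact: level_logn p_pr lR pb eX.
Qed.

Lemma dvd_level_reversal U R l l0 p : intertwiner S U R -> is_level R l -> is_level Q0 l0 ->
  prime p -> (p %| l)%N -> (p %| l0)%N.
Proof.
move=> iR lR lQ0 p_pr pl; have [_ p2] := level_intertwiner_sqf iR lR p_pr.
have p_odd : odd p by case: (even_prime p_pr) => // e2; rewrite pl in p2; have := p2 e2.
apply: contraLR pl => pl0; apply/(p_integralP p lR).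
apply: (reversal_integral det_walk sqf_z p_pr p_odd iR iQ0 (skew_reversal_sym iQ0)).
exact/(p_integralP p lQ0).
Qed.

(** A common prime would divide the level of [Q0] as well. Then neither [Q0] nor [Q] is integral
    there, and [transfer_integral] makes [Q0^T *m Q], which is [Q0 *m Q], integral: a
    contradiction. *)
Lemma coprime_levels l1 l2 l0 : is_level Q l1 -> is_level (Q0 *m Q) l2 -> is_level Q0 l0 ->
  coprime l1 l2.
Proof.
move=> lQ lR lQ0; have l1_gt0 : (0 < l1)%N by case: lQ.
have l2_gt0 : (0 < l2)%N by case: lR.
rewrite coprime_has_primes //; apply/hasPn=> p; rewrite !mem_primes => /and3P[p_pr _ pl2].
rewrite p_pr l1_gt0 /=; apply/negP=> pl1.
have [_ p2] := level_intertwiner_sqf iQ lQ p_pr.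
have p_odd : odd p by case: (even_prime p_pr) => // e2; rewrite pl1 in p2; have := p2 e2.
have npQ : ~ p_integral p Q by move/(p_integralP p lQ); rewrite pl1.
have npQ0 : ~ p_integral p Q0.
  by move/(p_integralP p lQ0); rewrite (dvd_level_reversal iQ lQ lQ0 p_pr pl1).
have := transfer_integral det_walk sqf_z p_pr p_odd iQ0 iQ npQ0 npQ.
by rewrite (skew_reversal_sym iQ0) => /(p_integralP p lR); rewrite pl2.
Qed.

Lemma perm_or_factorable : is_perm_mx Q \/ is_perm_mx (Q0 *m Q) \/ factorable Q0.
Proof.
have [l0 lQ0] := exists_level Q0; have [l1 lQ] := exists_level Q.
have [l2 lR] := exists_level (Q0 *m Q).
have [oQ _] := iQ; have [oQ0 _] := iQ0; have [oR _] := iQ0Q.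
have [pQ|npQ] := boolP (is_perm_mx Q); [by left | right].
have [pR|npR] := boolP (is_perm_mx (Q0 *m Q)); [by left | right].
have gt1 (A : 'M[rat]_n) l : reg_rat_orth A -> ~~ is_perm_mx A -> is_level A l -> (1 < l)%N.
  move=> oA npA lA; have [l_gt0 _] := lA; rewrite ltn_neqAle l_gt0 andbT.
  by apply: contraNneq npA => l1_eq; apply: level1_perm => //; rewrite l1_eq.
have l1_gt1 := gt1 _ _ oQ npQ lQ; have l2_gt1 := gt1 _ _ oR npR lR.
have l0_gt0 : (0 < l0)%N by case: lQ0.
have dvd_l0 U A l : intertwiner S U A -> is_level A l -> (l %| l0)%N.
  move=> iA lA; apply: dvdn_squarefree => // [|p p_pr|p p_pr]; first by case: lA.
    by case: (level_intertwiner_sqf iA lA p_pr).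
  exact: dvd_level_reversal iA lA lQ0 p_pr.
(* Both levels exceed 1, so this bound makes each of them smaller than [l0]. *)
have l12 : (l2 * l1 <= l0)%N.
  apply: dvdn_leq => //; rewrite Gauss_dvd ?(dvd_l0 _ _ _ iQ lQ) ?(dvd_l0 _ _ _ iQ0Q lR) //.
  by rewrite coprime_sym (coprime_levels lQ lR lQ0).
exists (Q0 *m Q), Q^T, l0, l2, l1; split=> //; split.
  by have [QQ _] := oQ; rewrite -mulmxA QQ mulmx1.
split=> //; split; first exact: reg_rat_orth_tr.
split=> //; split; first exact: level_tr.
by rewrite is_perm_mx_tr npQ npR; split; [nia | split; [nia | ]].
Qed.

End Main.

Theorem theorem5p2 (n : nat) (arc : rel 'I_n) (Q0 : 'M[rat]_n) :
  oriented arc -> in_Gn arc ->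
  reg_rat_orth Q0 ->
  Q0^T *m skew_adj arc *m Q0 = skew_adj (converse arc) ->
  ~ factorable Q0 ->
  WDGSS arc.
Proof.
case: n arc Q0 => [|n'] arc Q0 or_a.
  (* Without vertices all matrices coincide; the other case has positive size, where square matrices
     form a nonzero ring. *)
  by move=> _ _ _ _ b _ _; left; exists 1%g; apply/matrixP=> -[].
move=> [z [detW [odd_z sqf]]] oQ0 Q0S nfact b or_b [eqc eqJ].
pose S := int_skew arc; pose T := int_skew b.
have skS : S^T = - S by exact: int_skew_tr.
have det_walk : \det (krylov S n'.+1) = 2 ^+ n'.+1./2 * z.
  apply: (@intr_inj rat); rewrite -det_map_mx map_krylov ratmx_int_skew -walk_mxE detW.
  by rewrite intrM rmorphXn.
have odd_z2 : ~~ (2 %| z)%Z by rewrite dvdzE /= dvdn2 odd_z.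
have sqf_z p : prime p -> ~~ (p%:Z * p%:Z %| z)%Z by exact: squarefree_dvdz.
have [|Q [oQ SQ]] := exists_intertwiner (skew_adj_tr or_a) (skew_adj_tr or_b) eqc eqJ.
  rewrite -walk_mxE detW mulf_neq0 ?expf_neq0 // intr_eq0.
  by apply: contraNneq odd_z2 => ->; rewrite dvdz0.
have iQ : intertwiner S T Q by split; rewrite ?ratmx_int_skew.
have SQ0 : skew_adj arc *m Q0 = - (Q0 *m skew_adj arc).
  by have [QQ _] := oQ0; rewrite -mulmxN -skew_adj_converse // -Q0S !mulmxA QQ mul1mx.
have iQ0 : intertwiner S (- S) Q0.
  by split=> //; rewrite map_mxN ratmx_int_skew SQ0 mulmxN.
have SR : skew_adj arc *m (Q0 *m Q) = - (Q0 *m Q *m skew_adj b).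
  by rewrite mulmxA SQ0 mulNmx -!mulmxA SQ.
have oR : reg_rat_orth (Q0 *m Q) by exact: reg_rat_orthM.
have iR : intertwiner S (- T) (Q0 *m Q).
  by split=> //; rewrite map_mxN !ratmx_int_skew SR mulmxN.
have [pQ|[pR|//]] := perm_or_factorable skS det_walk odd_z2 sqf_z iQ iQ0 iR.
  by left; apply: is_perm_isomorphic oQ SQ pQ.
right; apply: is_perm_isomorphic oR _ pR.
by rewrite skew_adj_converse // mulNmx SR opprK.
Qed.
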